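(* Let $(S,P)$ and $(S_1,P_1)$ be two pure $\Gamma$-contractions on Hilbert spaces $\mathcal H$ and $\mathcal H_1$ respectively, and let $F_*\in\mathcal B(\mathcal D_{P^*})$ and $F_{1*}\in\mathcal B(\mathcal D_{P_1^*})$ be the fundamental operators of $(S^*,P^* )$ and $(S_1^*,P_1^* )$ respectively. Then $(S,P)$ is unitarily equivalent to $(S_1,P_1)$ (i.e. there is a unitary $U:\mathcal H\to\mathcal H_1$ with $US=S_1U$ and $UP=P_1U$) if and only if the characteristic functions of $P$ and $P_1$ coincide and $F_*$ and $F_{1*}$ are unitarily equivalent by the unitary from $\mathcal D_{P^*}$ to $\mathcal D_{P_1^*}$ that establishes this coincidence; that is, if and only if there exist unitaries $\sigma:\mathcal D_P\to\mathcal D_{P_1}$ and $\sigma_*:\mathcal D_{P^*}\to\mathcal D_{P_1^*}$ such that $$\sigma_*\Theta_P(z)=\Theta_{P_1}(z)\sigma\quad\text{for all } z\in\mathbb D,\qquad\text{and}\qquad \sigma_*F_*=F_{1*}\sigma_*.$$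
   Context: All Hilbert spaces are complex. Let $\Gamma=\{(z_1+z_2,z_1z_2): |z_1|\le 1,\ |z_2|\le 1\}\subseteq\mathbb C^2$ (the closed symmetrized bidisc). A pair $(S,P)$ of commuting bounded operators on a Hilbert space $\mathcal H$ is a $\Gamma$-contraction if $\Gamma$ is a spectral set for it; since $\Gamma$ is polynomially convex, this is equivalent to $\|p(S,P)\|\le \sup_{z\in\Gamma}|p(z)|$ for every complex polynomial $p$ in two variables. Then $P$ is a contraction, and $(S^*,P^* )$ is also a $\Gamma$-contraction. A $\Gamma$-contraction $(S,P)$ is pure if $P^{*n}\to 0$ strongly as $n\to\infty$. For a contraction $P$, put $D_P=(I-P^*P)^{1/2}$, $D_{P^*}=(I-PP^* )^{1/2}$, $\mathcal D_P=\overline{\mathrm{Ran}}\,D_P$, $\mathcal D_{P^*}=\overline{\mathrm{Ran}}\,D_{P^*}$. The fundamental operator of a $\Gamma$-contraction $(S,P)$ is the unique $F\in\mathcal B(\mathcal D_P)$ satisfying $S-S^*P=D_PFD_P$ (existence and uniqueness are known for every $\Gamma$-contraction). Thus the fundamental operator $F_*$ of $(S^*,P^* )$ is the unique $F_*\in\mathcal B(\mathcal D_{P^*})$ with $S^*-SP^*=D_{P^*}F_*D_{P^*}$. The characteristic function of a contraction $P$ is $\Theta_P(z)=[-P+zD_{P^*}(I-zP^* )^{-1}D_P]|_{\mathcal D_P}$, $z\in\mathbb D$, an analytic function with values in $\mathcal B(\mathcal D_P,\mathcal D_{P^*})$. The characteristic functions of contractions $P$ and $P_1$ coincide if there are unitaries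 $\sigma:\mathcal D_P\to\mathcal D_{P_1}$ and $\sigma_*:\mathcal D_{P^*}\to\mathcal D_{P_1^*}$ with $\sigma_*\Theta_P(z)=\Theta_{P_1}(z)\sigma$ for all $z\in\mathbb D$. *)

(* Defs.v *)
From HB Require Import structures.
From mathcomp Require Import all_boot all_order all_algebra.
From mathcomp Require Import sesquilinear complex.
From mathcomp Require Import all_classical all_reals all_analysis.
Import Order.TTheory GRing.Theory Num.Theory.
Import numFieldNormedType.Exports.

Set Implicit Arguments.
Unset Strict Implicit.
Unset Printing Implicit Defensive.

Local Open Scope classical_set_scope.
Local Open Scope ring_scope.

(* Complex Hilbert spaces, of arbitrary dimension. The inner product is linear
   in its first argument and conjugate-linear in its second. *)
HB.mixin Record CompleteNormedModule_isHilbert (R : realType) (H : Type)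
    of CompleteNormedModule R[i] H := {
  inner : {dot H for @Num.conj R[i]} ;
  sqr_norm_inner : forall x : H, `|x| ^+ 2 = inner x x
}.

#[short(type="hilbertType")]
HB.structure Definition Hilbert (R : realType) :=
  { H of CompleteNormedModule_isHilbert R H & CompleteNormedModule R[i] H }.

(* An operator between closed subspaces A of H and B of H' is represented by a
   function H -> H' of which only the values on A matter. *)
Section Operators.
Context {R : realType} {H H' : hilbertType R}.
Implicit Types (A : set H) (B : set H') (T : H -> H').

Definition linear_on A T :=
  forall (a : R[i]) x y, A x -> A y -> T (a *: x + y) = a *: T x + T y.

Definition bounded_operator_on A B T :=
  [/\ linear_on A T, set_fun A B T
    & exists c : R[i], forall x, A x -> `|T x| <= c * `|x| ].

Definition unitary_on A B T :=
  [/\ linear_on A T, T @` A = B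
    & forall x y, A x -> A y -> inner (T x) (T y) = inner x y ].

End Operators.

Section GammaContractions.
Context {R : realType} {H : hilbertType R}.
Implicit Types (T S P F : H -> H).

Definition bounded_operator T := bounded_operator_on setT setT T.

Definition opnorm T : R :=
  sup [set complex.Re `|T x| | x in [set x : H | `|x| <= 1]].

(* [get] picks the element of a set, and is junk on the empty set: [adjoint] is
   meaningful for bounded operators (Riesz), [sqrt_operator] for positive ones,
   where the chosen element exists and is unique. *)
Definition adjoint T : H -> H :=
  fun y => get [set z : H | forall x, inner (T x) y = inner x z].

Definition positive_operator T :=
  bounded_operator T /\ forall x, 0 <= inner (T x) x.

Definition sqrt_operator T : H -> H :=
  get [set B : H -> H | positive_operator B /\ B \o B = T].

Definition defect P : H -> H := sqrt_operator (fun x => x - adjoint P (P x)).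

Definition defect_space P : set H := closure (range (defect P)).

Definition Gamma : set (R[i] * R[i]) :=
  [set (z.1 + z.2, z.1 * z.2) | z in [set z | `|z.1| <= 1 /\ `|z.2| <= 1]].

(* {poly {poly R[i]}} as polynomials p(s, q) in two variables: p`_j`_i is the
   coefficient of s ^+ i * q ^+ j. *)
Definition sup_norm_on (K : set (R[i] * R[i])) (p : {poly {poly R[i]}}) : R :=
  sup [set complex.Re `|p.[z.2%:P].[z.1]| | z in K].

Definition poly_operator (p : {poly {poly R[i]}}) S P : H -> H :=
  fun x => \sum_(j < size p) \sum_(i < size p`_j)
             p`_j`_i *: iter i S (iter j P x).

(* Gamma is polynomially convex, so that "Gamma is a spectral set for (S, P)"
   amounts to von Neumann's inequality for polynomials. *)
Definition Gamma_contraction S P :=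
  [/\ bounded_operator S, bounded_operator P, S \o P = P \o S
    & forall p, opnorm (poly_operator p S P) <= sup_norm_on Gamma p ].

Definition pure P :=
  forall x, (fun n => iter n (adjoint P) x) @ \oo --> (0 : H).

Definition fundamental_operator F S P :=
  bounded_operator_on (defect_space P) (defect_space P) F /\
  forall x, S x - adjoint S (P x) = defect P (F (defect P x)).

(* Theta_P(z) is the restriction of [char_fun P z] to [defect_space P]. As
   P^** = P, [defect (adjoint P)] is (I - P P^* )^(1/2); [pinv setT f] is the
   inverse of f, here f = I - z P^*, which is bijective for |z| < 1. *)
Definition char_fun P (z : R[i]) : H -> H :=
  fun x => - P x +
    z *: defect (adjoint P)
           (pinv setT (fun y => y - z *: adjoint P y) (defect P x)).

End GammaContractions.

(* Main.v *)
(** With Q = P^*, the maps h |-> D_{P^*} Q^n h turn a pure contraction into a shift: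
    the sums of P^n D_{P^*} D_{P^*} Q^n h telescope to h - P^N Q^N h, which tends to h.
    The Gram matrix of the vectors P^n D_{P^*} e is a function of the Taylor
    coefficients of the characteristic function, because P D_P = D_{P^*} P and
    <P u, P v> = <u, v> - <D_P u, D_P v>.  A coincidence (sigma, sigma_* ) hence yields a
    unitary U sending P^n D_{P^*} e to P_1^n D_{P_1^*} (sigma_* e), and U intertwines P^*
    with P_1^*.  It intertwines S^* with S_1^* because
    <D_{P^*} S^* h, f> = <F_* D_{P^*} h, f> + <D_{P^*} P^* h, F_* f> on the defect space
    expresses D_{P^*} S^* through data that sigma_* transports. *)

Require Import Defs.
From mathcomp Require Import all_boot all_order all_algebra.
From mathcomp Require Import sesquilinear complex.
From mathcomp Require Import all_classical all_reals all_analysis.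
From mathcomp Require Import ring lra.
Import Order.TTheory GRing.Theory Num.Theory.
Import numFieldNormedType.Exports.

Set Implicit Arguments.
Unset Strict Implicit.
Unset Printing Implicit Defensive.

Local Open Scope classical_set_scope.
Local Open Scope ring_scope.

(** * Real part of the inner product *)

(** Adjoints and square roots are picked by [get] and inverses by [pinv], so existence must be
    supplied before their defining identities can be used: Riesz representation by minimising a
    quadratic functional, the root of I - A by a polynomial iteration, the inverse of I - zQ by a
    Neumann iteration. The polynomial nature of the iterates is also what yields P D_P = D_{P^*} P:
    whatever intertwines A with A' intertwines the iterates, hence the roots. Estimates run on the
    real part [rin] of the inner product, with values in the ordered field [R]; complex identities
    are recovered by replacing x with i x. An operator on a defect space is a function on all of H
    of which only the values on that subspace count. No adjoint of F_*, sigma or sigma_* is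
    therefore formed: identities that would need one are tested against the vectors of a subspace,
    or proved on the range of a defect operator and extended by a limit. *)

Lemma ltr0c {R : realType} (r : R) : (0 < r%:C%C) = (0 < r).
Proof. by rewrite ltcR. Qed.

Section InnerProduct.
Context {R : realType} {H : hilbertType R}.
Implicit Types (x y z : H) (a : R[i]) (r : R).

Definition rin x y : R := complex.Re (inner x y).

Definition nrm x : R := complex.Re `|x|.

Lemma normE x : `|x| = (nrm x)%:C%C.
Proof. by rewrite /nrm RRe_real// normr_real. Qed.

Lemma innerC x y : inner x y = ((inner y x)^*)%C.
Proof. by rewrite (hermC inner) expr0 mul1r. Qed.

Lemma rinC x y : rin x y = rin y x.
Proof. by rewrite /rin innerC; case: (inner y x). Qed.

Lemma rinDl x y z : rin (x + y) z = rin x z + rin y z.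
Proof. by rewrite /rin linearDl/=; case: (inner x z); case: (inner y z). Qed.

Lemma rinNl x z : rin (- x) z = - rin x z.
Proof. by rewrite /rin linearNl/=; case: (inner x z). Qed.

Lemma rinZl r x z : rin (r%:C%C *: x) z = r * rin x z.
Proof.
by rewrite /rin linearZl_LR/=; case: (inner x z) => p q /=; rewrite mul0r subr0.
Qed.

Lemma rinDr x y z : rin z (x + y) = rin z x + rin z y.
Proof. by rewrite !(rinC z) rinDl. Qed.

Lemma rinNr x z : rin z (- x) = - rin z x.
Proof. by rewrite !(rinC z) rinNl. Qed.

Lemma rinZr r x z : rin z (r%:C%C *: x) = r * rin z x.
Proof. by rewrite !(rinC z) rinZl. Qed.

Lemma rinBl x y z : rin (x - y) z = rin x z - rin y z.
Proof. by rewrite rinDl rinNl. Qed.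

Lemma rinBr x y z : rin z (x - y) = rin z x - rin z y.
Proof. by rewrite rinDr rinNr. Qed.

Lemma rin0l z : rin 0 z = 0.
Proof. by rewrite -(subrr z) rinBl subrr. Qed.

Lemma rin0r z : rin z 0 = 0.
Proof. by rewrite rinC rin0l. Qed.

Lemma rinil x y : rin ('i%C *: x) y = - complex.Im (inner x y).
Proof.
by rewrite /rin linearZl_LR/=; case: (inner x y) => p q /=; rewrite mul0r mul1r add0r.
Qed.

Lemma innerE x y : inner x y = (rin x y +i* - rin ('i%C *: x) y)%C.
Proof. by rewrite rinil opprK /rin; case: (inner x y). Qed.

Lemma rin_ii x y : rin ('i%C *: x) ('i%C *: y) = rin x y.
Proof.
rewrite rinil innerC linearZl_LR/= /rin [inner x y]innerC.
by case: (inner y x) => p q /=; rewrite mul0r mul1r add0r opprK.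
Qed.

Lemma innerxx x : inner x x = (nrm x ^+ 2)%:C%C.
Proof. by rewrite -sqr_norm_inner normE rmorphXn. Qed.

Lemma rinxx x : rin x x = nrm x ^+ 2.
Proof. by rewrite /rin innerxx. Qed.

Lemma nrm_ge0 x : 0 <= nrm x.
Proof. by rewrite -ler0c -normE. Qed.

Lemma nrm0 : nrm 0 = 0.
Proof. by rewrite /nrm normr0. Qed.

Lemma nrm_eq0 x : nrm x = 0 -> x = 0.
Proof. by move=> x0; apply/eqP; rewrite -normr_eq0 normE x0. Qed.

Lemma rinxx_eq0 x : rin x x = 0 -> x = 0.
Proof.
by rewrite rinxx => /eqP; rewrite sqrf_eq0 => /eqP; exact: nrm_eq0.
Qed.

Lemma nrmN x : nrm (- x) = nrm x.
Proof. by rewrite /nrm normrN. Qed.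

Lemma nrmBC x y : nrm (x - y) = nrm (y - x).
Proof. by rewrite /nrm distrC. Qed.

Lemma nrmD x y : nrm (x + y) <= nrm x + nrm y.
Proof.
rewrite -lecR; have := ler_normD x y.
by rewrite !normE -rmorphD.
Qed.

Lemma nrmB x y : nrm (x - y) <= nrm x + nrm y.
Proof. by rewrite (le_trans (nrmD _ _))// nrmN. Qed.

Lemma nrm_tri y x z : nrm (x - z) <= nrm (x - y) + nrm (y - z).
Proof. by rewrite -(subrKA y x (- z)) nrmD. Qed.

Lemma nrmZ a x : nrm (a *: x) = complex.Re `|a| * nrm x.
Proof.
rewrite /nrm normrZ normE -(RRe_real (normr_real a)) /=.
by rewrite mulr0 subr0.
Qed.

Lemma nrmZr r x : nrm (r%:C%C *: x) = `|r| * nrm x.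
Proof. by rewrite nrmZ normc_def/= expr0n addr0 sqrtr_sqr. Qed.

Lemma sqr_nrmD x y : nrm (x + y) ^+ 2 = nrm x ^+ 2 + 2 * rin x y + nrm y ^+ 2.
Proof. by rewrite -!rinxx !rinDl !rinDr (rinC y x); ring. Qed.

Lemma sqr_nrmB x y : nrm (x - y) ^+ 2 = nrm x ^+ 2 - 2 * rin x y + nrm y ^+ 2.
Proof. by rewrite sqr_nrmD rinNr nrmN; ring. Qed.

Lemma cauchy_schwarz x y : rin x y <= nrm x * nrm y.
Proof.
have : nrm (x + y) ^+ 2 <= (nrm x + nrm y) ^+ 2.
  by rewrite ler_sqr ?nnegrE ?addr_ge0 ?nrm_ge0// nrmD.
rewrite sqr_nrmD sqrrD; nra.
Qed.

Lemma rin_ext x y : (forall z, rin z x = rin z y) -> x = y.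
Proof.
move=> xy; apply/eqP; rewrite -subr_eq0; apply/eqP/rinxx_eq0.
by rewrite rinBr xy subrr.
Qed.

End InnerProduct.

(** * Norm convergence with real tolerances, and closures *)

Section Convergence.
Context {R : realType} {H : hilbertType R}.
Implicit Types (u v : nat -> H) (x y : H).

Definition tends u x :=
  forall e : R, 0 < e -> exists N, forall n, (N <= n)%N -> nrm (u n - x) < e.

Lemma cvg_tends u x : u @ \oo --> x -> tends u x.
Proof.
move=> /cvgr_dist_lt ux e e0.
have /ux : 0 < e%:C%C by rewrite ltr0c.
move=> [N _ uN]; exists N => n Nn; rewrite -ltcR -normE distrC.
exact: uN.
Qed.

Definition cauchy_tends u := forall e : R, 0 < e ->
  exists N, forall m n, (N <= m)%N -> (N <= n)%N -> nrm (u m - u n) < e.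

Lemma hilbert_complete u : cauchy_tends u -> exists x, tends u x.
Proof.
move=> cu; suff : cvg (u @ \oo) by move=> uc; exists (lim (u @ \oo)); exact: cvg_tends.
apply: cauchy_cvg; apply: cauchy_exP => e e0.
have eE : e = (complex.Re e)%:C%C by rewrite RRe_real// gtr0_real.
have /cu[N uN] : 0 < complex.Re e by rewrite -ltr0c -eE.
exists (u N); exists N => // n /= Nn.
by rewrite -ball_normE /ball_/= eE normE ltcR; exact: uN.
Qed.

Lemma tends_unique u x y : tends u x -> tends u y -> x = y.
Proof.
move=> ux uy; apply/eqP; rewrite -subr_eq0; apply/eqP/nrm_eq0/eqP.
rewrite eq_le nrm_ge0 andbT leNgt; apply/negP => xy.
have e0 : 0 < nrm (x - y) / 2 by rewrite divr_gt0.
have [N uN] := ux _ e0; have [M uM] := uy _ e0.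
have := uN (maxn N M) (leq_maxl _ _); have := uM (maxn N M) (leq_maxr _ _).
have := nrm_tri (u (maxn N M)) x y; rewrite (nrmBC x (u _)); lra.
Qed.

Lemma tends_cauchy u x : tends u x -> cauchy_tends u.
Proof.
move=> ux e e0; have /ux[N uN] : 0 < e / 2 by rewrite divr_gt0.
exists N => m n Nm Nn; have := uN _ Nm; have := uN _ Nn.
have := nrm_tri x (u m) (u n); rewrite (nrmBC x (u n)); lra.
Qed.

Lemma tendsD u v x y : tends u x -> tends v y -> tends (fun n => u n + v n) (x + y).
Proof.
move=> ux vy e e0; have e2 : 0 < e / 2 by rewrite divr_gt0.
have [N uN] := ux _ e2; have [M vM] := vy _ e2.
exists (maxn N M) => n; rewrite geq_max => /andP[/uN un /vM vn].
by rewrite opprD addrACA (le_lt_trans (nrmD _ _))//; lra.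
Qed.

Lemma tends_cst x : tends (fun=> x) x.
Proof. by move=> e e0; exists 0%N => n _; rewrite subrr nrm0. Qed.

Lemma tends_shift u x : tends u x -> tends (fun n => u n.+1) x.
Proof.
by move=> ux e /ux[N uN]; exists N => n Nn; apply: uN; exact: leqW.
Qed.

Lemma eq_tends u v x : u =1 v -> tends u x -> tends v x.
Proof. by move=> uv ux e /ux[N uN]; exists N => n /uN; rewrite uv. Qed.

Lemma tendsZ (a : R[i]) u x : tends u x -> tends (fun n => a *: u n) (a *: x).
Proof.
move=> ux e e0; set c := complex.Re `|a|.
have c0 : 0 <= c by rewrite -ler0c RRe_real ?normr_real.
have /ux[N uN] : 0 < e / (c + 1) by rewrite divr_gt0// ltr_wpDl.
exists N => n /uN; rewrite -scalerBr nrmZ -/c ltr_pdivlMr ?ltr_wpDl//.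
have := nrm_ge0 (u n - x); nra.
Qed.

Lemma rin_le_lim u x y (c : R) :
  tends u x -> (forall n, rin (u n) y <= c) -> rin x y <= c.
Proof.
move=> ux uc; apply/ler_addgt0Pr => e e0.
have y1 : 0 < nrm y + 1 by rewrite ltr_wpDl ?nrm_ge0.
have /ux[N /(_ _ (leqnn N))] : 0 < e / (nrm y + 1) by rewrite divr_gt0.
rewrite nrmBC ltr_pdivlMr// => xN.
have := cauchy_schwarz (x - u N) y; rewrite rinBl.
have := uc N; have := nrm_ge0 (x - u N); nra.
Qed.

Lemma rin_eq_lim u x y (c : R) :
  tends u x -> (forall n, rin (u n) y = c) -> rin x y = c.
Proof.
move=> ux uc; apply/eqP; rewrite eq_le; apply/andP; split.
  by apply: rin_le_lim ux _ => n; rewrite uc.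
rewrite -[rin _ _]opprK lerNr -rinNr.
by apply: rin_le_lim ux _ => n; rewrite rinNr uc.
Qed.

Lemma nrm_le_lim u x (c : R) : 0 <= c ->
  tends u x -> (forall n, nrm (u n) <= c) -> nrm x <= c.
Proof.
move=> c0 ux uc; apply/ler_addgt0Pr => e /ux[N /(_ _ (leqnn N))].
rewrite nrmBC => xN; have := nrmD (x - u N) (u N); rewrite subrK.
by have := uc N; lra.
Qed.

Lemma closure_nrm (A : set H) x :
  closure A x <-> forall e : R, 0 < e -> exists2 y, A y & nrm (x - y) < e.
Proof.
split=> [Ax e e0|Ax B].
  have /Ax[y [Ay]] : nbhs x (ball x e%:C%C) by apply: nbhsx_ballx; rewrite ltr0c.
  by rewrite -ball_normE/= normE ltcR => xy; exists y.
move=> /nbhs_ballP[e /= e0]; rewrite -ball_normE => eB.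
have eE : e = (complex.Re e)%:C%C by rewrite RRe_real// gtr0_real.
have /Ax[y Ay xy] : 0 < complex.Re e by rewrite -ltr0c -eE.
by exists y; split => //; apply: eB; rewrite /= eE normE ltcR.
Qed.

Lemma closure_tends (A : set H) x :
  closure A x -> exists2 u : nat -> H, (forall n, A (u n)) & tends u x.
Proof.
move=> /closure_nrm Ax.
have /choice[u uP] : forall n : nat, exists y, A y /\ nrm (x - y) < n.+1%:R^-1.
  by move=> n; have [|y Ay xy] := Ax n.+1%:R^-1; [rewrite invr_gt0|exists y].
exists u => [n|e e0]; first by case: (uP n).
have [N Ne] : exists N : nat, N.+1%:R^-1 < e.
  exists (Num.truncn e^-1); rewrite invf_plt ?posrE//.
  exact: truncnS_gt.
exists N => n Nn; rewrite nrmBC (lt_trans _ Ne)//.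
rewrite (lt_le_trans (uP n).2)// lef_pV2 ?posrE ?ltr0n// ler_nat ltnS//.
Qed.

End Convergence.

(** * Bounded operators and adjoints *)

Section Operators.
Context {R : realType} {H H' : hilbertType R}.
Implicit Types (T : H -> H') (x y : H).

Definition lin T := forall (a : R[i]) x y, T (a *: x + y) = a *: T x + T y.

Definition bdop T := lin T /\
  exists2 c : R, 0 <= c & forall x, nrm (T x) <= c * nrm x.

Lemma lin0 T : lin T -> T 0 = 0.
Proof.
move=> linT; have := linT 1 0 0; rewrite !scale1r addr0.
by move/(congr1 (fun u => u - T 0)); rewrite subrr addrK.
Qed.

Lemma linD T x y : lin T -> T (x + y) = T x + T y.
Proof. by move=> linT; rewrite -[x in LHS]scale1r linT scale1r. Qed.

Lemma linZ T (a : R[i]) x : lin T -> T (a *: x) = a *: T x.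
Proof. by move=> linT; rewrite -[a *: x]addr0 linT lin0// addr0. Qed.

Lemma linN T x : lin T -> T (- x) = - T x.
Proof. by move=> linT; rewrite -scaleN1r linZ// scaleN1r. Qed.

Lemma linB T x y : lin T -> T (x - y) = T x - T y.
Proof. by move=> linT; rewrite linD// linN. Qed.

Lemma bdop_lin T : bdop T -> lin T. Proof. by case. Qed.

Lemma tends_lipschitz T (c : R) (u : nat -> H) x : 0 <= c ->
  (forall n, nrm (T (u n) - T x) <= c * nrm (u n - x)) ->
  tends u x -> tends (T \o u) (T x).
Proof.
move=> c0 Tc ux e e0; have /ux[N uN] : 0 < e / (c + 1).
  by rewrite divr_gt0// ltr_wpDl.
exists N => n /uN; rewrite ltr_pdivlMr ?ltr_wpDl//= => un.
have := Tc n; have := nrm_ge0 (u n - x); nra.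
Qed.

Lemma tends_bdop T (u : nat -> H) x :
  bdop T -> tends u x -> tends (T \o u) (T x).
Proof.
move=> [linT [c c0 Tc]]; apply: (tends_lipschitz c0) => n.
by rewrite -linB.
Qed.

End Operators.

Section Adjoint.
Context {R : realType} {H : hilbertType R}.
Implicit Types (T : H -> H) (x y : H).

Lemma bounded_operatorE T : bounded_operator T -> bdop T.
Proof.
move=> [Tlin _ [c Tc]]; split; first by move=> a x y; exact: Tlin.
(* The given bound is a complex number, and on the zero space it may be any number; the absolute
   value of its real part is a safe real bound. *)
exists `|complex.Re c| => // x.
have := Tc x I; rewrite !normE lecE => /andP[_].
have -> : complex.Re (c * (nrm x)%:C%C) = complex.Re c * nrm x.
  by case: (c) => p q /=; rewrite mulr0 subr0.
move=> /le_trans; apply; by rewrite ler_wpM2r ?nrm_ge0 ?ler_norm.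
Qed.

Lemma bdop_bounded_operator T : bdop T -> bounded_operator T.
Proof.
move=> [linT [c c0 Tc]]; split=> [a x y _ _||]; [exact: linT|by []|].
by exists c%:C%C => x _; rewrite !normE -rmorphM lecR.
Qed.

Lemma rinZC (a : R[i]) x y : rin x (a *: y) = rin ((a^*)%C *: x) y.
Proof.
rewrite /rin linearZl_LR [in LHS]innerC linearZl_LR/= [inner x y]innerC.
by case: a => p q; case: (inner y x) => s t /=; ring.
Qed.

(** The hypothesis at i x supplies the imaginary parts. The two maps may land in different spaces,
    so that adjoints and isometries are both covered. *)
Lemma inner_ext (K K' : hilbertType R) (V : H -> K) (W : H -> K')
    (y : K) (z : K') : lin V -> lin W ->
  (forall x, rin (V x) y = rin (W x) z) -> forall x, inner (V x) y = inner (W x) z.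
Proof.
by move=> Vl Wl VW x; rewrite !innerE -(linZ _ _ Vl) -(linZ _ _ Wl) !VW.
Qed.

Section Riesz.
Variables (phi : H -> R) (c : R).
Hypothesis phiD : forall x y, phi (x + y) = phi x + phi y.
Hypothesis phiZ : forall (r : R) x, phi (r%:C%C *: x) = r * phi x.
Hypothesis c_ge0 : 0 <= c.
Hypothesis phi_le : forall x, phi x <= c * nrm x.

(** If z represents [phi], then J x = |x - z|^2 - |z|^2, so z can be found as the minimiser of
    [J]. *)
Let J x := rin x x - 2 * phi x.

Let JD x y : J (x + y) = J x + 2 * (rin x y - phi y) + rin y y.
Proof. by rewrite /J phiD rinDl !rinDr (rinC y x); ring. Qed.

Let J_ge x : - c ^+ 2 <= J x.
Proof.
rewrite /J rinxx; have := phi_le x; have := sqr_ge0 (nrm x - c).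
by rewrite sqrrB; lra.
Qed.

Lemma riesz : exists z, forall x, phi x = rin x z.
Proof.
have Jinf : has_inf (range J).
  by split; [exists (J 0); exists 0|exists (- c ^+ 2) => _ [x _ <-]; exact: J_ge].
set m := inf (range J).
have Jm x : m <= J x by apply: ge_inf; [case: Jinf|exists x].
have /choice[u uP] : forall n : nat, exists x, J x < m + n.+1%:R^-1.
  move=> n; have [|_ [x _ <-] Jx] := inf_adherent (_ : 0 < n.+1%:R^-1 :> R) Jinf.
    by rewrite invr_gt0.
  by exists x.
have small (e : R) : 0 < e -> exists N : nat, forall n, (N <= n)%N -> n.+1%:R^-1 < e :> R.
  move=> e0; exists (Num.truncn e^-1) => n Nn; rewrite invf_plt ?posrE//.
  by rewrite (lt_le_trans (truncnS_gt _))// ler_nat ltnS.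
have [z uz] : exists z, tends u z.
  apply: hilbert_complete => e e0.
  (* Parallelogram law: with w the midpoint and d half the difference of [u k] and [u l], J(w + d) +
     J(w - d) = 2 J(w) + 2 |d|^2. As J(w) is at least m, |2d|^2 is less than twice the sum of the
     two excesses over m, hence less than e^2. *)
  have [|N Ne] := small (e ^+ 2 / 4); first by rewrite divr_gt0// exprn_gt0.
  exists N => k l /Ne Nk /Ne Nl.
  have h2 : (2^-1 : R)%:C%C + (2^-1)%:C%C = 1.
    by rewrite -rmorphD; have -> : 2^-1 + 2^-1 = 1 :> R by field.
  have Eu : u k = (2^-1 : R)%:C%C *: (u k + u l) + (2^-1 : R)%:C%C *: (u k - u l).
    by rewrite scalerBr scalerDr addrACA subrr addr0 -scalerDl h2 scale1r.
  have El : u l = (2^-1 : R)%:C%C *: (u k + u l) - (2^-1 : R)%:C%C *: (u k - u l).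
    by rewrite -scalerBr opprB addrC subrKA scalerDr -scalerDl h2 scale1r.
  have Jk := uP k; rewrite [u k]Eu JD !rinZr !rinZl phiZ in Jk.
  have Jl := uP l; rewrite [u l]El -scalerN JD !rinZr !rinZl phiZ in Jl.
  have := Jm ((2^-1 : R)%:C%C *: (u k + u l)).
  have phiN x : phi (- x) = - phi x.
    have -> : - x = (-1 : R)%:C%C *: x by rewrite rmorphN1 scaleN1r.
    by rewrite phiZ mulN1r.
  rewrite phiN !rinNr rinNl in Jl.
  rewrite -ltr_sqr ?nnegrE ?nrm_ge0// ?(ltW e0)// -rinxx.
  move: Nk Nl Jk Jl; move: (k.+1%:R^-1) (l.+1%:R^-1) (J _) => ik il Jw.
  by lra.
exists z => x.
have Jz : J z <= m.
  apply/ler_addgt0Pr => e e0.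
  have e2 : 0 < e / 2 by rewrite divr_gt0.
  (* Expanding [J] at z, the linear term in u n - z has norm at most 2 (|z| + c); the added 1 keeps
     the divisor positive. *)
  have d0 : 0 < 2 * (nrm z + c) + 1 by rewrite ltr_wpDl// mulr_ge0// addr_ge0// nrm_ge0.
  have [N1 uN1] := small _ e2.
  have [N2 uN2] := uz _ (divr_gt0 e2 d0).
  have := uN1 _ (leq_maxl N1 N2); have := uN2 _ (leq_maxr N1 N2).
  set n := maxn N1 N2; rewrite ltr_pdivlMr// => un ne.
  have := uP n; rewrite -[u n](subrK z) [_ - _ + z]addrC JD.
  have := phi_le (u n - z); have := cauchy_schwarz (- z) (u n - z).
  rewrite nrmN rinNl rinxx.
  have := nrm_ge0 (u n - z); have := sqr_ge0 (nrm (u n - z)).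
  move: un ne; move: (n.+1%:R^-1) (J _) (nrm _) => *; lra.
(* Moving from the minimiser z by t x with t = - d / (|x|^2 + 1) gives 0 <= 2 t d + t^2 |x|^2 = -
   t^2 (|x|^2 + 2), so t = 0 and d = 0. The 1 in the denominator covers x = 0. *)
have := Jm (z + (- (rin z x - phi x) / (nrm x ^+ 2 + 1))%:C%C *: x).
rewrite JD !rinZr !rinZl phiZ rinxx rinC.
set d := rin x z - phi x; set q := nrm x ^+ 2 + 1; set t := - d / q.
have q0 : 0 < q by rewrite ltr_wpDl// sqr_ge0.
have tq : t * q = - d by rewrite /t mulfVK// gt_eqF.
move=> Jt; have : 0 <= 2 * t * d + t ^+ 2 * nrm x ^+ 2.
  by move: Jt Jz; rewrite /d; nra.
have dE : d = - (t * q) by rewrite tq opprK.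
rewrite {1}dE /q => t0.
have t2 : t ^+ 2 <= 0 by have := sqr_ge0 t; have := sqr_ge0 (nrm x); nra.
have : t = 0 by apply/eqP; rewrite -sqrf_eq0 eq_le t2 sqr_ge0.
move=> t00; move: dE; rewrite t00 mul0r oppr0 /d; lra.
Qed.

End Riesz.

(** Riesz applied to the real functional x |-> Re <T x, y> shows that the set from which [adjoint]
    picks is not empty. *)
Lemma rin_adjoint T x y : bdop T -> rin (T x) y = rin x (adjoint T y).
Proof.
move=> [linT [c c0 Tc]].
suff /getPex : exists z, forall x, inner (T x) y = inner x z.
  by move=> adjP; rewrite /rin adjP.
have [|r u||u|z zP] := @riesz (fun x => rin (T x) y) (c * nrm y).
- by move=> u v; rewrite linD// rinDl.
- by rewrite linZ// rinZl.
- by rewrite mulr_ge0// nrm_ge0.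
- rewrite (le_trans (cauchy_schwarz _ _))// mulrAC ler_wpM2r ?nrm_ge0//.
by by exists z; apply: (inner_ext linT (_ : lin id)).
Qed.

Lemma adjoint_lin T : bdop T -> lin (adjoint T).
Proof.
move=> bT a x y; apply: rin_ext => z.
by rewrite rinDr rinZC -!rin_adjoint// rinDr rinZC -linZ//; exact: bdop_lin.
Qed.

Lemma adjoint_bdop T : bdop T -> bdop (adjoint T).
Proof.
move=> bT; split; first exact: adjoint_lin.
have [_ [c c0 Tc]] := bT; exists c => // y.
have := cauchy_schwarz (T (adjoint T y)) y.
rewrite rin_adjoint// rinxx; have := Tc (adjoint T y).
have := nrm_ge0 y; have := nrm_ge0 (adjoint T y).
set p := nrm (adjoint T y); set q := nrm (T _) => p0 y0 qp pq.
have [->|p_neq0] := eqVneq p 0; first by rewrite mulr_ge0.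
by rewrite -(ler_pM2r (_ : 0 < p)) ?lt0r ?p_neq0//; nra.
Qed.

Lemma adjoint_unique T T' : bdop T ->
  (forall x y, rin (T x) y = rin x (T' y)) -> adjoint T = T'.
Proof.
by move=> bT TT'; apply/funext => y; apply: rin_ext => x; rewrite -rin_adjoint.
Qed.

Lemma adjointK T : bdop T -> adjoint (adjoint T) = T.
Proof.
move=> bT; apply: adjoint_unique; first exact: adjoint_bdop.
by move=> x y; rewrite rinC -rin_adjoint// rinC.
Qed.

Lemma adjoint_contraction T : bdop T ->
  (forall x, nrm (T x) <= nrm x) -> forall x, nrm (adjoint T x) <= nrm x.
Proof.
move=> bT Tc y.
have := cauchy_schwarz (T (adjoint T y)) y.
rewrite rin_adjoint// rinxx; have := Tc (adjoint T y).
have := nrm_ge0 y; have := nrm_ge0 (adjoint T y).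
set p := nrm (adjoint T y); set q := nrm (T _) => p0 y0 qp pq.
have [->//|p_neq0] := eqVneq p 0.
by rewrite -(ler_pM2r (_ : 0 < p)) ?lt0r ?p_neq0//; nra.
Qed.

End Adjoint.

(** * Positive square roots *)

Section Limits.
Context {R : realType} {H H' : hilbertType R}.

(** Passes an equality of inner products to the limit when its two sides live in different spaces,
    as they do when data of [P] are compared with data of [P1]. *)
Lemma rin_lim2 (u : nat -> H) (v : nat -> H') x y a b :
  tends u x -> tends v y -> (forall n, rin (u n) a = rin (v n) b) ->
  rin x a = rin y b.
Proof.
move=> ux vy uv; apply/eqP; rewrite -subr_eq0 -normr_le0; apply/ler_addgt0Pr => e e0.
have c0 : 0 < nrm a + nrm b + 1 by rewrite ltr_wpDl// addr_ge0// nrm_ge0.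
have [N uN] := ux _ (divr_gt0 e0 c0); have [M vM] := vy _ (divr_gt0 e0 c0).
have := uN _ (leq_maxl N M); have := vM _ (leq_maxr N M).
set n := maxn N M; rewrite !ltr_pdivlMr// => vn un.
have := uv n.
have := cauchy_schwarz (u n - x) a; have := cauchy_schwarz (- (u n - x)) a.
have := cauchy_schwarz (v n - y) b; have := cauchy_schwarz (- (v n - y)) b.
have := nrm_ge0 (u n - x); have := nrm_ge0 (v n - y).
have := nrm_ge0 a; have := nrm_ge0 b.
rewrite !nrmN !rinNl !rinBl add0r ler_norml.
move: un vn; move: (nrm (u n - x)) (nrm (v n - y)) (nrm a) (nrm b) => p q s t.
move: (rin (u n) a) (rin (v n) b) (rin x a) (rin y b) => k l z w.
move=> h1 h2 t0 s0 q0 p0 h3 h4 h5 h6 h7.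
have : p * s + q * t <= e.
  have [pq|/ltW pq] := lerP p q; first by have := ler_wpM2r s0 pq; nra.
  by have := ler_wpM2r t0 pq; nra.
by move=> pq; apply/andP; split; lra.
Qed.

End Limits.

Section PositiveOperators.
Context {R : realType} {H : hilbertType R}.
Implicit Types (T B C : H -> H) (x y : H).

Definition symmetric T := forall x y, rin (T x) y = rin x (T y).

Lemma scaleii x : 'i%C *: ('i%C *: x) = - x.
Proof.
rewrite scalerA; have -> : 'i%C * 'i%C = -1 :> R[i]; last by rewrite scaleN1r.
by rewrite -expr2 sqr_i.
Qed.

Lemma symmetric_positive_operator T : bdop T -> symmetric T ->
  (forall x, 0 <= rin (T x) x) -> positive_operator T.
Proof.
move=> bT symT T0; split; first exact: bdop_bounded_operator.
move=> x; rewrite innerE.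
have -> : rin ('i%C *: T x) x = 0.
  have : rin ('i%C *: T x) x = - rin ('i%C *: T x) x; last lra.
  rewrite -{1}linZ; last exact: bdop_lin.
  by rewrite symT -rin_ii scaleii rinNl rinC.
by rewrite oppr0 ler0c.
Qed.

Lemma positive_operator_ge0 T x : positive_operator T -> 0 <= rin (T x) x.
Proof. by move=> [_ /(_ x)]; rewrite lecE => /andP[]. Qed.

(* Polarisation in a complex space: a real quadratic form forces symmetry. *)
Lemma positive_operator_symmetric T : positive_operator T -> symmetric T.
Proof.
move=> [/bounded_operatorE/bdop_lin linT T0].
have im0 x : rin ('i%C *: T x) x = 0.
  have := T0 x; rewrite innerE lecE => /andP[/eqP/= + _]; lra.
move=> x y; have := im0 ('i%C *: x + y).
rewrite (linD _ _ linT) (linZ _ _ linT) scalerDr scaleii rinDl !rinDr.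
have -> : rin (- T x) ('i%C *: x) = 0.
  by rewrite -scaleii rin_ii im0.
rewrite im0 rinNl rin_ii; rewrite (rinC x); lra.
Qed.

(** Positivity is tested at x - t B x with t = d / (c + 1): the value is - 2 t d + t^2 c = - t^2 (c
    + 2), which forces t = 0 and hence d = |B x|^2 = 0. *)
Lemma positive_kernel B x : lin B -> symmetric B ->
  (forall x, 0 <= rin (B x) x) -> rin (B x) x = 0 -> B x = 0.
Proof.
move=> B_lin symB B0 Bx0; apply: rinxx_eq0; 
set d := rin _ _; set c := rin (B (B x)) (B x); have c0 : 0 <= c by exact: B0.
set t := d / (c + 1); have c1 : c + 1 != 0 by rewrite gt_eqF// ltr_wpDl.
have dE : d = t * (c + 1) by rewrite /t mulfVK.
have := B0 (x - t%:C%C *: B x).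
rewrite (linB _ _ B_lin) (linZ _ _ B_lin) rinBl !rinBr !rinZl !rinZr Bx0 -/c.
rewrite (symB (B x) x) -/d => h.
have : t ^+ 2 * (c + 2) <= 0 by move: h; rewrite dE; lra.
rewrite pmulr_lle0 ?ltr_wpDl// => t2; rewrite dE.
have /eqP : t ^+ 2 = 0 by apply/eqP; rewrite eq_le t2 sqr_ge0.
by rewrite sqrf_eq0 => /eqP ->; rewrite mul0r.
Qed.

End PositiveOperators.

Section SquareRoot.
Context {R : realType}.

(* The iteration Y := (A + Y^2) / 2 converges to I - (I - A)^(1/2). *)
Fixpoint sqrt_iter {H : hilbertType R} (A : H -> H) n : H -> H :=
  if n is m.+1 then
    fun x => (2^-1)%:C%C *: (A x + sqrt_iter A m (sqrt_iter A m x))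
  else fun=> 0.

(** The same iteration run on the scalar 1 in place of A. It is increasing and bounded by 1, and it
    majorises the norms of the iterates and of their increments, so its convergence forces
    theirs. *)
Fixpoint sqrt_bound n : R :=
  if n is m.+1 then (1 + sqrt_bound m ^+ 2) / 2 else 0.

Lemma sqrt_bound_ge0 n : 0 <= sqrt_bound n.
Proof. by elim: n => //= n n0; rewrite divr_ge0// addr_ge0// sqr_ge0. Qed.

Lemma sqrt_bound_le1 n : sqrt_bound n <= 1.
Proof. by elim: n => //= n n1; have := sqrt_bound_ge0 n; nra. Qed.

Lemma sqrt_bound_leS n : sqrt_bound n <= sqrt_bound n.+1.
Proof. by have := sqr_ge0 (sqrt_bound n - 1); rewrite /= sqrrB; lra. Qed.

Lemma sqrt_bound_mono m n : (m <= n)%N -> sqrt_bound m <= sqrt_bound n.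
Proof.
elim: n => [|n IH]; first by rewrite leqn0 => /eqP->.
rewrite leq_eqVlt => /orP[/eqP->//|]; rewrite ltnS => /IH /le_trans; apply.
exact: sqrt_bound_leS.
Qed.

Lemma sqrt_bound_cauchy (e : R) : 0 < e ->
  exists N, forall n, (N <= n)%N -> sqrt_bound n - sqrt_bound N < e.
Proof.
move=> e0; have hs : has_sup (range sqrt_bound).
  by split; [exists 0; exists 0%N|exists 1 => _ [n _ <-]; exact: sqrt_bound_le1].
have [_ [N _ <-] sN] := sup_adherent e0 hs; exists N => n _.
have : sqrt_bound n <= sup (range sqrt_bound) by apply: ub_le_sup; [case: hs|exists n].
lra.
Qed.

(** Each iterate is a polynomial in A with real coefficients and no constant term. With X an iterate
    itself, this gives the commutation of the iterates. *)
Lemma sqrt_iter_intertwine (H H' : hilbertType R) (A : H -> H) (A' : H' -> H')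
    (X : H -> H') n x : lin X -> (forall x, X (A x) = A' (X x)) ->
  X (sqrt_iter A n x) = sqrt_iter A' n (X x).
Proof.
move=> linX XA; elim: n x => [|n IH] x /=; first exact: lin0.
by rewrite (linZ _ _ linX) (linD _ _ linX) XA !IH.
Qed.

Context {H : hilbertType R} (A : H -> H).
Hypotheses (linA : lin A) (symA : symmetric A).
Hypothesis nrmA : forall x, nrm (A x) <= nrm x.
Local Notation Y := (sqrt_iter A).

Let Y_lin n : lin (Y n).
Proof.
elim: n => [|n IH] a x y /=; first by rewrite scaler0 addr0.
by rewrite linA !IH addrACA -[a *: A x + _]scalerDr [LHS]scalerDr !scalerA [_ * a]mulrC.
Qed.

Let Y_sym n : symmetric (Y n).
Proof.
elim: n => [|n IH] x y /=; first by rewrite rin0l rin0r.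
by rewrite rinZl rinZr rinDl rinDr symA !IH.
Qed.

Let Y_bound n x : nrm (Y n x) <= sqrt_bound n * nrm x.
Proof.
elim: n x => [|n IH] x /=; first by rewrite nrm0 mul0r.
rewrite nrmZr ger0_norm ?invr_ge0//.
have := nrmD (A x) (Y n (Y n x)); have := nrmA x; have := IH (Y n x).
have := ler_wpM2l (sqrt_bound_ge0 n) (IH x); lra.
Qed.

Let Y_comm m n x : Y m (Y n x) = Y n (Y m x).
Proof.
apply: sqrt_iter_intertwine => // z; apply/esym.
by apply: sqrt_iter_intertwine.
Qed.

Let YS n x : Y n.+1 x = (2^-1)%:C%C *: (A x + Y n (Y n x)).
Proof. by []. Qed.

Let Y_step n x : nrm (Y n.+1 x - Y n x) <= (sqrt_bound n.+1 - sqrt_bound n) * nrm x.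
Proof.
elim: n x => [|n IH] x; first by rewrite /= !subr0; exact: Y_bound 1 x.
(* Since the iterates commute, half the difference of two squares factors as half the increment
   applied to the sum; the scalar sequence satisfies the same factorisation. *)
have -> : Y n.+2 x - Y n.+1 x =
    (2^-1)%:C%C *: (Y n.+1 (Y n.+1 x + Y n x) - Y n (Y n.+1 x + Y n x)).
  rewrite (linD _ _ (Y_lin n.+1)) (linD _ _ (Y_lin n)) (Y_comm n.+1 n) opprD addrA.
  rewrite addrK YS [in X in _ - X = _]YS -scalerBr opprD addrACA subrr add0r//.
rewrite nrmZr ger0_norm ?invr_ge0//.
have := IH (Y n.+1 x + Y n x); have := nrmD (Y n.+1 x) (Y n x).
have := Y_bound n.+1 x; have := Y_bound n x.
have := sqrt_bound_leS n; rewrite [sqrt_bound n.+2]/= -/(sqrt_bound n.+1).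
have -> : sqrt_bound n.+1 = (1 + sqrt_bound n ^+ 2) / 2 by [].
set p := sqrt_bound n; set q := (1 + p ^+ 2) / 2; move=> pq h1 h2 h3 h4.
have : (q - p) * nrm (Y n.+1 x + Y n x) <= (q - p) * ((q + p) * nrm x).
  by apply: ler_wpM2l; lra.
move: h4; move: (nrm (Y n.+1 _ - _)) => a h4 h5.
have -> : ((1 + q ^+ 2) / 2 - q) * nrm x = 2^-1 * ((q - p) * ((q + p) * nrm x)).
  by rewrite /q; field.
by rewrite ler_wpM2l ?invr_ge0// (le_trans h4).
Qed.

Let Y_dist m n x : (m <= n)%N ->
  nrm (Y n x - Y m x) <= (sqrt_bound n - sqrt_bound m) * nrm x.
Proof.
elim: n => [|n IH]; first by rewrite leqn0 => /eqP->; rewrite !subrr nrm0 mul0r.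
rewrite leq_eqVlt => /orP[/eqP->|]; first by rewrite !subrr nrm0 mul0r.
rewrite ltnS => /IH h.
have := nrm_tri (Y n x) (Y n.+1 x) (Y m x); have := Y_step n x; lra.
Qed.

Lemma sqrt_iter_cvg : exists Yoo : H -> H, forall x, tends (fun n => Y n x) (Yoo x).
Proof.
suff /choice[Yoo YooP] : forall x, exists y, tends (fun n => Y n x) y by exists Yoo.
move=> x; apply: hilbert_complete => e e0.
have x1 : 0 < 2 * nrm x + 1 by rewrite ltr_wpDl// mulr_ge0// nrm_ge0.
have [N NP] := sqrt_bound_cauchy (divr_gt0 e0 x1); exists N => m n Nm Nn.
have := NP _ Nm; have := NP _ Nn; have := Y_dist x Nm; have := Y_dist x Nn.
rewrite !ltr_pdivlMr// (nrmBC (Y n x)).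
have := nrm_tri (Y N x) (Y m x) (Y n x).
have := sqrt_bound_mono Nm; have := sqrt_bound_mono Nn; have := nrm_ge0 x; nra.
Qed.

Section Limit.
Variable Yoo : H -> H.
Hypothesis YooP : forall x, tends (fun n => Y n x) (Yoo x).
Let B x := x - Yoo x.

Let Yoo_lin : lin Yoo.
Proof.
move=> a x y; apply: tends_unique (YooP _) _.
have := tendsD (tendsZ a (YooP x)) (YooP y); apply: eq_tends => n.
by rewrite Y_lin.
Qed.

Let Yoo_bound x : nrm (Yoo x) <= nrm x.
Proof.
apply: nrm_le_lim (YooP x) _ => [|n]; first exact: nrm_ge0.
have := Y_bound n x; have := sqrt_bound_le1 n; have := nrm_ge0 x; nra.
Qed.

Let Yoo_sqr x : Yoo x = (2^-1)%:C%C *: (A x + Yoo (Yoo x)).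
Proof.
apply: (tends_unique (tends_shift (YooP x))).
apply/tendsZ/tendsD; first exact: tends_cst.
have -> : Yoo (Yoo x) = 0 + Yoo (Yoo x) by rewrite add0r.
(* Both the operator and its argument vary in Y_n (Y_n x). The part on the moving difference
   vanishes because every Y_n is a contraction. *)
have : tends (fun n => Y n (Y n x - Yoo x) + Y n (Yoo x)) (0 + Yoo (Yoo x)).
  apply: tendsD (YooP _) => e /(YooP x)[N NP]; exists N => n /NP; apply: le_lt_trans.
  rewrite subr0; have := Y_bound n (Y n x - Yoo x); have := sqrt_bound_le1 n.
  have := nrm_ge0 (Y n x - Yoo x); nra.
by apply: eq_tends => n; rewrite -linD// subrK.
Qed.

Let B_lin : lin B.
Proof. by move=> a x y; rewrite /B Yoo_lin opprD addrACA -scalerBr. Qed.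

Let B_bdop : bdop B.
Proof.
split=> //; exists 2 => // x; have := nrmB x (Yoo x); have := Yoo_bound x.
by rewrite /B; lra.
Qed.

Let B_sym : symmetric B.
Proof.
move=> x y; rewrite /B rinBl rinBr; congr (_ - _); rewrite [RHS]rinC.
by apply: rin_lim2 (YooP x) (YooP y) _ => n; rewrite Y_sym rinC.
Qed.

Let B_ge0 x : 0 <= rin (B x) x.
Proof.
rewrite rinBl rinxx; have := cauchy_schwarz (Yoo x) x; have := Yoo_bound x.
have := nrm_ge0 x; nra.
Qed.

Let B_sqr x : B (B x) = x - A x.
Proof.
have E : Yoo x + Yoo x = A x + Yoo (Yoo x).
  rewrite {1 2}Yoo_sqr -scalerDl -rmorphD; have -> : 2^-1 + 2^-1 = 1 :> R by field.
  by rewrite scale1r.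
rewrite /B linB// opprB addrA addrAC -[_ - Yoo x - Yoo x]addrA -opprD E opprD.
by rewrite addrA subrK.
Qed.

(** The limit is a positive root, so [get] returns some positive root C; the rest is uniqueness. C
    commutes with A = I - C^2, hence with B. For D = B - C this gives B D + C D = B^2 - C^2 = 0;
    both forms being positive, B D = C D = 0, so D^2 = 0 and, by symmetry, D = 0. *)
Lemma sqrt_operator_limit x : sqrt_operator (fun x => x - A x) x = B x.
Proof.
rewrite /sqrt_operator; case: (getPex (_ : exists C : H -> H,
    positive_operator C /\ C \o C = fun x => x - A x)).
  exists B; split; first exact: symmetric_positive_operator.
  by apply/funext => z; exact: B_sqr.
set C := get _ => C_pos CC.
have C_sqr z : C (C z) = z - A z by rewrite -[LHS]/((C \o C) z) CC.
have C_bdop : bdop C by apply: bounded_operatorE; case: C_pos.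
have C_lin := bdop_lin C_bdop.
have C_sym := positive_operator_symmetric C_pos.
have AE z : A z = z - C (C z) by rewrite C_sqr opprB addrC subrK.
have CA z : C (A z) = A (C z) by rewrite !AE linB.
have CY z : C (Yoo z) = Yoo (C z).
  apply: tends_unique (tends_bdop C_bdop (YooP z)) _.
  by apply: eq_tends (YooP (C z)) => n /=; rewrite (sqrt_iter_intertwine _ _ C_lin CA).
have CB z : C (B z) = B (C z) by rewrite /B linB// CY.
pose D z := B z - C z.
have D_lin : lin D by move=> a z w; rewrite /D B_lin C_lin opprD addrACA -scalerBr.
have D_sym : symmetric D by move=> z w; rewrite /D rinBl rinBr B_sym C_sym.
have BCD z : B (D z) + C (D z) = 0.
  by rewrite /D linB// linB// CB B_sqr C_sqr addrA subrK subrr.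
have BD0 z : B (D z) = 0 /\ C (D z) = 0.
  have : rin (B (D z)) (D z) + rin (C (D z)) (D z) = 0 by rewrite -rinDl BCD rin0l.
  have := B_ge0 (D z); have := positive_operator_ge0 (D z) C_pos => h1 h2 h3.
  split; apply: positive_kernel => //; [|by move=> w; exact: positive_operator_ge0|]; lra.
have D0 z : D z = 0.
  apply: rinxx_eq0; rewrite D_sym /D -/(D z) (BD0 z).1 (BD0 z).2 subrr rin0r//.
by apply/esym/eqP; rewrite -subr_eq0 -/(D x) D0.
Qed.

Lemma sqrt_limit_spec : [/\ bdop B, symmetric B & forall x, B (B x) = x - A x].
Proof. by split; [exact: B_bdop|exact: B_sym|exact: B_sqr]. Qed.

End Limit.

Local Notation B := (sqrt_operator (fun x => x - A x)).

Lemma sqrt_operator_tends x : tends (fun n => Y n x) (x - B x).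
Proof.
have [Yoo YooP] := sqrt_iter_cvg.
by rewrite (sqrt_operator_limit YooP) opprB addrC subrK.
Qed.

Lemma sqrt_operator_spec :
  [/\ bdop B, symmetric B & forall x, B (B x) = x - A x].
Proof.
have [Yoo YooP] := sqrt_iter_cvg.
have -> : B = fun x => x - Yoo x by apply/funext => x; exact: sqrt_operator_limit.
exact: sqrt_limit_spec.
Qed.

End SquareRoot.

Lemma sqrt_operator_intertwine {R : realType} {H H' : hilbertType R}
    (A : H -> H) (A' : H' -> H') (X : H -> H') x :
  lin A -> symmetric A -> (forall x, nrm (A x) <= nrm x) ->
  lin A' -> symmetric A' -> (forall x, nrm (A' x) <= nrm x) ->
  bdop X -> (forall x, X (A x) = A' (X x)) ->
  X (sqrt_operator (fun x => x - A x) x) = sqrt_operator (fun x => x - A' x) (X x).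
Proof.
move=> A1 A2 A3 A1' A2' A3' bX XA.
have := tends_bdop bX (sqrt_operator_tends A1 A2 A3 x).
have := sqrt_operator_tends A1' A2' A3' (X x).
move=> h1 h2; have := tends_unique h2 (eq_tends _ h1).
rewrite linB; last exact: bdop_lin.
move=> /(_ (fun n => esym (sqrt_iter_intertwine n x (bdop_lin bX) XA))).
by move=> /addrI/oppr_inj.
Qed.

(** * Contractions and defect operators *)

Section Contractions.
Context {R : realType}.

Definition contraction (H : hilbertType R) (P : H -> H) :=
  bdop P /\ forall x, nrm (P x) <= nrm x.

Lemma contraction_adjoint (H : hilbertType R) (P : H -> H) :
  contraction P -> contraction (adjoint P).
Proof.
by move=> [bP nP]; split; [exact: adjoint_bdop|exact: adjoint_contraction].
Qed.

Lemma bdop_comp (H H' H'' : hilbertType R) (T : H -> H') (T' : H' -> H'') :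
  bdop T -> bdop T' -> bdop (T' \o T).
Proof.
move=> [linT [c c0 Tc]] [linT' [c' c'0 T'c]]; split.
  by move=> a x y; rewrite /= linT linT'.
exists (c' * c) => [|x /=]; first exact: mulr_ge0.
by rewrite (le_trans (T'c _))// -mulrA ler_wpM2l.
Qed.

Section Defect.
Context {H : hilbertType R} (P : H -> H).
Hypothesis cP : contraction P.
Let bP : bdop P. Proof. by case: cP. Qed.

Lemma adjoint_mul_self :
  [/\ lin (fun x => adjoint P (P x)), symmetric (fun x => adjoint P (P x))
    & forall x, nrm (adjoint P (P x)) <= nrm x].
Proof.
split=> [||x]; first exact: (bdop_lin (bdop_comp bP (adjoint_bdop bP))).
  by move=> x y; rewrite -rin_adjoint// rinC -rin_adjoint// rinC.
by rewrite (le_trans (adjoint_contraction bP cP.2 _))// cP.2.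
Qed.

Lemma defect_bdop : bdop (defect P).
Proof. by have [l s n] := adjoint_mul_self; case: (sqrt_operator_spec l s n). Qed.

Lemma defect_sym : symmetric (defect P).
Proof. by have [l s n] := adjoint_mul_self; case: (sqrt_operator_spec l s n). Qed.

Lemma defect_sqr x : defect P (defect P x) = x - adjoint P (P x).
Proof.
by have [l s n] := adjoint_mul_self; case: (sqrt_operator_spec l s n) => _ _ /(_ x).
Qed.

Lemma defect_spaceP x : defect_space P (defect P x).
Proof. by apply: subset_closure; exists x. Qed.

End Defect.

Lemma defect_intertwine (H H' : hilbertType R) (P : H -> H) (P' : H' -> H')
    (X : H -> H') x : contraction P -> contraction P' -> bdop X ->
  (forall x, X (adjoint P (P x)) = adjoint P' (P' (X x))) ->
  X (defect P x) = defect P' (X x).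
Proof.
move=> /adjoint_mul_self[l s n] /adjoint_mul_self[l' s' n'] bX XP.
exact: sqrt_operator_intertwine.
Qed.

Section DefectDuality.
Context {H : hilbertType R} (P : H -> H).
Hypothesis cP : contraction P.
Let bP : bdop P. Proof. by case: cP. Qed.

Lemma defect_adjoint_sqr x :
  defect (adjoint P) (defect (adjoint P) x) = x - P (adjoint P x).
Proof.
by rewrite defect_sqr; [rewrite adjointK|exact: contraction_adjoint].
Qed.

Lemma contraction_defect x : P (defect P x) = defect (adjoint P) (P x).
Proof.
apply: defect_intertwine => //; first exact: contraction_adjoint.
by move=> y; rewrite adjointK.
Qed.

Lemma adjoint_defect x :
  adjoint P (defect (adjoint P) x) = defect P (adjoint P x).
Proof.
apply: defect_intertwine => //; first exact: contraction_adjoint.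
  by apply: adjoint_bdop; case: cP.
by move=> y; rewrite adjointK.
Qed.

End DefectDuality.

(** * Invertibility of I - zQ for a contraction Q and |z| < 1 *)

Section Resolvent.
Context {H : hilbertType R} (Q : H -> H) (z : R[i]).
Hypotheses (cQ : contraction Q) (z1 : `|z| < 1).
Local Notation r := (complex.Re `|z| : R).
Let r0 : 0 <= r. Proof. by rewrite -ler0c RRe_real ?normr_real. Qed.
Let r1 : r < 1. Proof. by rewrite -ltcR RRe_real ?normr_real. Qed.
Let Qlin : lin Q. Proof. by case: cQ => /bdop_lin. Qed.
Local Notation f := (fun y : H => y - z *: Q y).

Let nrm_zQ x : nrm (z *: Q x) <= r * nrm x.
Proof. by rewrite nrmZ ler_wpM2l// cQ.2. Qed.

Lemma resolvent_inj x y : f x = f y -> x = y.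
Proof.
move=> fxy; apply/eqP; rewrite -subr_eq0; apply/eqP/nrm_eq0.
have E : x - y = z *: Q (x - y).
  rewrite (linB _ _ Qlin) scalerBr; move/(congr1 (fun u => u + z *: Q x - y)): fxy.
  by rewrite subrK => ->; rewrite addrAC [y - _]addrC addrK addrC.
have := nrm_zQ (x - y); rewrite -E; have := nrm_ge0 (x - y); have := r1.
by move=> *; apply/eqP; rewrite eq_le; apply/andP; split; nra.
Qed.

Lemma resolvent_surj w : exists y, f y = w.
Proof.
(* Iterating from 0 produces the partial sums of the Neumann series of (zQ)^k w. The factor 1 - r in
   the two bounds below stands for the sum of the geometric series. *)
pose y := fix y n := if n is m.+1 then w + z *: Q (y m) else 0.
have y_bound n : (1 - r) * nrm (y n) <= nrm w.
  elim: n => [|n IH]; first by rewrite nrm0 mulr0 nrm_ge0.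
  rewrite -[y n.+1]/(w + z *: Q (y n)).
  have h : nrm (w + z *: Q (y n)) <= nrm w + r * nrm (y n).
    by rewrite (le_trans (nrmD _ _))// lerD2l.
  have := ler_wpM2l r0 IH; have := ler_wpM2l (_ : 0 <= 1 - r) h.
  by rewrite subr_ge0 => /(_ (ltW r1)); lra.
have y_dist n k : (1 - r) * nrm (y (n + k)%N - y n) <= r ^+ n * nrm w.
  elim: n => [|n IH]; first by rewrite subr0 expr0 mul1r add0n.
  rewrite addSn -[y _.+1]/(w + z *: Q (y (n + k)%N)) -[y n.+1]/(w + z *: Q (y n)).
  rewrite addrAC opprD addrA subrr sub0r addrC -scalerBr -(linB _ _ Qlin) exprS.
  have r1' : 0 <= 1 - r by rewrite subr_ge0 ltW.
  have := ler_wpM2l r1' (nrm_zQ (y (n + k)%N - y n)); have := ler_wpM2l r0 IH; lra.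
have rn0 (e : R) : 0 < e -> exists n, r ^+ n < e.
  move=> e0; have := @cvg_expr R r; rewrite ger0_norm// => /(_ r1).
  move=> /cvgr_dist_lt/(_ _ e0)[N _ /(_ N (leqnn N))].
  by rewrite /= sub0r normrN ger0_norm ?exprn_ge0// => h; exists N.
have [x yx] : exists x, tends y x.
  apply: hilbert_complete => e e0.
  have d0 : 0 < 2 * nrm w + 1 by rewrite ltr_wpDl// mulr_ge0// nrm_ge0.
  have r1' : 0 < 1 - r by rewrite subr_gt0.
  have [N rN] := rn0 _ (divr_gt0 (mulr_gt0 e0 r1') d0); exists N => m n Nm Nn.
  have := y_dist N (m - N)%N; have := y_dist N (n - N)%N; rewrite !subnKC// => h1 h2.
  move: rN; rewrite ltr_pdivlMr// => rN.
  have h3 := nrm_tri (y N) (y m) (y n); rewrite (nrmBC (y N) (y n)) in h3.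
  rewrite -(ltr_pM2l r1'); have := ler_wpM2l (ltW r1') h3; have := exprn_ge0 N r0; lra.
exists x; have := tendsD (tends_cst w) (tendsZ z (tends_bdop cQ.1 yx)).
by move/(tends_unique (tends_shift yx)) => {1}->; rewrite addrK.
Qed.

Lemma pinv_resolvent w : f (pinv setT f w) = w.
Proof.
by apply: pinvK; have [y yw] := resolvent_surj w; rewrite inE; exists y.
Qed.

End Resolvent.

(** * From the spectral set condition to contractivity of P *)

Lemma poly_operator_X (H : hilbertType R) (S P : H -> H) :
  poly_operator 'X S P = P.
Proof.
apply/funext => x; rewrite /poly_operator size_polyX 2!big_ord_recl big_ord0 addr0.
rewrite [in X in X + _]coefX size_poly0 big_ord0 add0r coefX size_poly1.
by rewrite big_ord_recl big_ord0 addr0 coef1 scale1r.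
Qed.

Lemma sup_norm_on_Gamma_X : sup_norm_on (@Gamma R) 'X <= 1.
Proof.
apply: ge_sup.
  by exists (complex.Re `|('X : {poly {poly R[i]}}).[(0 * 0)%:P].[0 + 0]|);
    exists (0 + 0, 0 * 0) => //; exists (0, 0) => //=; rewrite normr0 ler01.
move=> _ [_ [[a b] [/= a1 b1] <-] <-]; rewrite hornerX hornerC.
have ab1 : `|a * b| <= 1 by rewrite normrM mulr_ile1.
by rewrite -lecR; exact: ab1.
Qed.

(** The outer variable ['X] is the second coordinate, a product of two numbers of the closed disc,
    so the inequality for it bounds [opnorm P] by 1. That [sup] dominates |P y| at a unit vector y
    requires its set to be bounded above, which is the boundedness of P. *)
Lemma Gamma_contraction_contraction (H : hilbertType R) (S P : H -> H) :
  Gamma_contraction S P -> contraction P.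
Proof.
move=> [_ bP _ /(_ 'X)]; rewrite poly_operator_X => Pp.
have {}bP := bounded_operatorE bP.
split=> //; have P1 : opnorm P <= 1 := le_trans Pp sup_norm_on_Gamma_X.
move=> x; have [c c0 Pc] := bP.2.
have [x0|x0] := eqVneq (nrm x) 0; first by rewrite (nrm_eq0 x0) (lin0 (bdop_lin bP)).
have x_gt0 : 0 < nrm x by rewrite lt0r x0 nrm_ge0.
set y := ((nrm x)^-1)%:C%C *: x.
have Py : nrm (P y) <= 1.
  apply: le_trans P1; apply: ub_le_sup; last first.
    exists y => //; apply: (_ : `|y| <= 1).
    by rewrite normE lecR nrmZr ger0_norm ?invr_ge0 ?nrm_ge0// mulVf.
  exists c => _ [u /= u1 <-]; apply: (le_trans (Pc u)).
  by rewrite ler_piMr//; move: u1; rewrite normE lecR.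
move: Py; rewrite /y (linZ _ _ (bdop_lin bP)) nrmZr ger0_norm ?invr_ge0 ?nrm_ge0//.
by rewrite ler_pdivrMl// mulr1.
Qed.

End Contractions.

(** * Defect spaces and fundamental operators *)

Section Subspaces.
Context {R : realType}.

Definition subspace (H : hilbertType R) (A : set H) :=
  A 0 /\ forall (a : R[i]) x y, A x -> A y -> A (a *: x + y).

Lemma subspaceB (H : hilbertType R) (A : set H) x y :
  subspace A -> A x -> A y -> A (x - y).
Proof. by move=> [_ sA] Ax Ay; rewrite addrC -scaleN1r; apply: sA. Qed.

Section Linear.
Context {H H' : hilbertType R} (A : set H) (T : H -> H').
Hypotheses (sA : subspace A) (linT : linear_on A T).

Lemma linear_on0 : T 0 = 0.
Proof.
have := linT 1 sA.1 sA.1; rewrite !scale1r addr0.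
by move/(congr1 (fun u => u - T 0)); rewrite subrr addrK.
Qed.

Lemma linear_onZ (a : R[i]) x : A x -> T (a *: x) = a *: T x.
Proof.
by move=> Ax; rewrite -[a *: x]addr0 (linT _ Ax sA.1) linear_on0 addr0.
Qed.

Lemma linear_onB x y : A x -> A y -> T (x - y) = T x - T y.
Proof.
by move=> Ax Ay; rewrite addrC -scaleN1r (linT _ Ay Ax) scaleN1r addrC.
Qed.

Lemma tends_bounded_operator_on (B : set H') (u : nat -> H) x :
  bounded_operator_on A B T -> (forall n, A (u n)) -> A x ->
  tends u x -> tends (T \o u) (T x).
Proof.
move=> [_ _ [c Tc]] Au Ax.
have c0 : 0 <= `|complex.Re c| by [].
apply: (tends_lipschitz c0) => n; rewrite -linear_onB//.
have := Tc _ (subspaceB sA (Au n) Ax); rewrite !normE lecE => /andP[_].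
have -> : complex.Re (c * (nrm (u n - x))%:C%C) = complex.Re c * nrm (u n - x).
  by case: (c) => p q /=; rewrite mulr0 subr0.
move=> /le_trans; apply; by rewrite ler_wpM2r ?nrm_ge0 ?ler_norm.
Qed.

End Linear.

Lemma unitary_on_rin (H H' : hilbertType R) (A : set H) (B : set H')
    (T : H -> H') x y :
  unitary_on A B T -> A x -> A y -> rin (T x) (T y) = rin x y.
Proof. by move=> [_ _ iT] Ax Ay; rewrite /rin iT. Qed.

Lemma unitary_on_mem (H H' : hilbertType R) (A : set H) (B : set H')
    (T : H -> H') x : unitary_on A B T -> A x -> B (T x).
Proof. by move=> [_ <- _] Ax; exists x. Qed.

Lemma unitary_on_surj (H H' : hilbertType R) (A : set H) (B : set H')
    (T : H -> H') y : unitary_on A B T -> B y -> exists2 x, A x & T x = y.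
Proof. by move=> [_ <- _] [x Ax <-]; exists x. Qed.

Lemma unitary_on_ext (H H' : hilbertType R) (A : set H) (B : set H')
    (T : H -> H') v w : unitary_on A B T -> B v -> B w ->
  (forall x, A x -> rin v (T x) = rin w (T x)) -> v = w.
Proof.
move=> uT Bv Bw vw; have [x Ax xv] := unitary_on_surj uT Bv.
have [y Ay yw] := unitary_on_surj uT Bw.
apply/eqP; rewrite -subr_eq0; apply/eqP/rinxx_eq0.
rewrite rinBr -{2}xv -{3}yw !rinBl.
by rewrite (vw _ Ax) (vw _ Ay) !subrr.
Qed.

Lemma closure_idem_tends (H : hilbertType R) (A : set H) (u : nat -> H) x :
  (forall n, closure A (u n)) -> tends u x -> closure A x.
Proof.
move=> Au ux; apply/closure_nrm => e e0.
have e2 : 0 < e / 2 by rewrite divr_gt0.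
have [N /(_ _ (leqnn N))] := ux _ e2; rewrite nrmBC => xu.
have /closure_nrm/(_ _ e2)[y Ay uy] := Au N.
by exists y => //; have := nrm_tri (u N) x y; lra.
Qed.

End Subspaces.

Section DefectSpace.
Context {R : realType} {H : hilbertType R} (P : H -> H).
Hypothesis cP : contraction P.

Lemma defect_lin : lin (defect P).
Proof. by have [] := defect_bdop cP. Qed.

Lemma nrm_defect x : nrm (defect P x) <= nrm x.
Proof.
have := defect_sqr cP x => /(congr1 (rin x)).
rewrite rinBr -(defect_sym cP) -(rin_adjoint _ _ cP.1) !rinxx => E.
rewrite -ler_sqr ?nnegrE ?nrm_ge0// E.
by rewrite gerBl ?sqr_ge0.
Qed.

Lemma sqr_nrm_defect x y :
  rin (P x) (P y) = rin x y - rin (defect P x) (defect P y).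
Proof.
by rewrite (defect_sym cP) (defect_sqr cP) rinBr -(rin_adjoint _ _ cP.1); ring.
Qed.

Lemma defect_space_tends x : defect_space P x ->
  exists a : nat -> H, tends (fun n => defect P (a n)) x.
Proof.
move=> /closure_tends[u Au ux].
have /choice[a aP] : forall n, exists b, defect P b = u n.
  by move=> n; have [b _ bu] := Au n; exists b.
by exists a; apply: eq_tends ux => n; rewrite aP.
Qed.

Lemma defect_space_subspace : subspace (defect_space P).
Proof.
split; first by rewrite -(lin0 defect_lin); exact: defect_spaceP.
move=> a x y /defect_space_tends[u ux] /defect_space_tends[v vy].
apply: closure_idem_tends (tendsD (tendsZ a ux) vy) => n.
by rewrite -defect_lin; exact: defect_spaceP.
Qed.

(** The kernel of a symmetric operator is orthogonal to its range, hence to the closure of the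
    range, where v - w lies. *)
Lemma defect_inj_on v w : defect_space P v -> defect_space P w ->
  defect P v = defect P w -> v = w.
Proof.
move=> /defect_space_tends[a av] /defect_space_tends[b bw] vw.
have D0 x : rin (defect P x) (v - w) = 0.
  by rewrite defect_sym// (linB _ _ defect_lin) vw subrr rin0r.
apply/eqP; rewrite -subr_eq0; apply/eqP/rinxx_eq0.
rewrite rinBl (rin_eq_lim av (c := 0)) ?(rin_eq_lim bw (c := 0)) ?subrr// => n;
  exact: D0.
Qed.

Lemma fundamental_tends (S F : H -> H) (u : nat -> H) x :
  fundamental_operator F S P -> (forall n, defect_space P (u n)) ->
  defect_space P x -> tends u x -> tends (F \o u) (F x).
Proof.
move=> [bF _] Au Ax; apply: (tends_bounded_operator_on _ _ bF) => //.
  exact: defect_space_subspace.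
by case: bF.
Qed.

(** A weak form of D_P S = F D_P + F^* D_P P, with F^* moved to the other side. For f = D_P y the
    defining equation turns the terms with F into <y, S h> - <S y, P h> and <S y, P h> - <P y, P S
    h>; the middle terms cancel and leave <D_P y, D_P S h>. A limit gives all f. *)
Lemma fundamental_adjoint_rin (S F : H -> H) h f : bdop S ->
  (forall x, S (P x) = P (S x)) -> fundamental_operator F S P ->
  defect_space P f ->
  rin (defect P (S h)) f = rin (F (defect P h)) f + rin (defect P (P h)) (F f).
Proof.
move=> bS SP fF Ef; have [bF FE] := fF.
have [a af] := defect_space_tends Ef.
have Faf := fundamental_tends fF (fun n => @defect_spaceP _ _ P (a n)) Ef af.
rewrite (rinC _ (F f)).
have -> : rin (F f) (defect P (P h)) = rin f (defect P (S h) - F (defect P h)).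
  apply: (rin_lim2 Faf af) => n /=; set y := a n.
  have E1 : rin (F (defect P y)) (defect P (P h)) =
      rin (S y) (P h) - rin (P y) (P (S h)).
    rewrite -(defect_sym cP) -FE rinBl; congr (_ - _).
    by rewrite rinC -(rin_adjoint _ _ bS) SP rinC.
  have E2 : rin (defect P y) (F (defect P h)) = rin y (S h) - rin (S y) (P h).
    by rewrite (defect_sym cP) -FE rinBr -(rin_adjoint _ _ bS).
  by rewrite E1 rinBr E2 sqr_nrm_defect; ring.
by rewrite rinBr !(rinC f) addrC subrK.
Qed.

End DefectSpace.

(** * Transport along a unitary *)

Section UnitaryEquivalence.
Context {R : realType} {H H1 : hilbertType R} (U : H -> H1).
Hypothesis uU : unitary_on setT setT U.

Lemma unitary_lin : lin U.
Proof. by have [linU _ _] := uU => a x y; exact: linU. Qed.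

Lemma unitary_rin x y : rin (U x) (U y) = rin x y.
Proof. exact: unitary_on_rin uU I I. Qed.

Lemma unitary_surj y : exists x, U x = y.
Proof. by have [x _ <-] := unitary_on_surj uU (I : [set: H1] y); exists x. Qed.

Lemma unitary_nrm x : nrm (U x) = nrm x.
Proof.
by apply/eqP; rewrite -(@eqrXn2 _ 2) ?nrm_ge0// -!rinxx unitary_rin.
Qed.

Lemma unitary_bdop : bdop U.
Proof.
split; first exact: unitary_lin.
by exists 1 => // x; rewrite mul1r unitary_nrm.
Qed.

Lemma unitary_adjoint (T : H -> H) (T1 : H1 -> H1) x : bdop T -> bdop T1 ->
  (forall x, U (T x) = T1 (U x)) -> U (adjoint T x) = adjoint T1 (U x).
Proof.
move=> bT bT1 UT; apply: rin_ext => y; have [z <-] := unitary_surj y.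
by rewrite unitary_rin -rin_adjoint// -rin_adjoint// -UT unitary_rin.
Qed.

Section Defect.
Variables (P : H -> H) (P1 : H1 -> H1).
Hypotheses (cP : contraction P) (cP1 : contraction P1).
Hypothesis UP : forall x, U (P x) = P1 (U x).

Lemma unitary_defect x : U (defect P x) = defect P1 (U x).
Proof.
apply: defect_intertwine => //; first exact: unitary_bdop.
by move=> y; rewrite -UP (unitary_adjoint _ cP.1 cP1.1 UP).
Qed.

Lemma unitary_defect_space :
  unitary_on (defect_space P) (defect_space P1) U.
Proof.
split; [by move=> a x y _ _; exact: unitary_lin| |
  by have [_ _ iU] := uU => x y _ _; exact: iU].
apply/seteqP; split=> [_ [x /closure_nrm Ex <-]|y1].
  apply/closure_nrm => e /Ex[_ [w _ <-] xw]; exists (U (defect P w)).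
    by rewrite unitary_defect; exists (U w).
  by rewrite -(linB _ _ unitary_lin) unitary_nrm.
have [x <-] := unitary_surj y1 => /closure_nrm Ex.
exists x => //; apply/closure_nrm => e /Ex[_ [w1 _ <-]].
have [w <-] := unitary_surj w1.
rewrite -unitary_defect -(linB _ _ unitary_lin) unitary_nrm => xw.
by exists (defect P w) => //; exists w.
Qed.

End Defect.

Lemma unitary_char_fun (P : H -> H) (P1 : H1 -> H1) (z : R[i]) x :
  contraction P -> contraction P1 -> (forall x, U (P x) = P1 (U x)) ->
  `|z| < 1 -> U (char_fun P z x) = char_fun P1 z (U x).
Proof.
move=> cP cP1 UP z1.
have cQ := contraction_adjoint cP; have cQ1 := contraction_adjoint cP1.
have UQ y := unitary_adjoint y cP.1 cP1.1 UP.
rewrite /char_fun addrC unitary_lin (unitary_defect cQ cQ1 UQ) (linN _ unitary_lin).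
rewrite UP addrC; congr (_ + _ *: defect _ _).
(* The inverses are compared after applying I - z Q1 to both sides. *)
apply: (resolvent_inj cQ1 z1) => /=.
rewrite (pinv_resolvent cQ1 z1) -UQ -(linZ _ _ unitary_lin) -(linB _ _ unitary_lin).
by rewrite (pinv_resolvent cQ z1) (unitary_defect cP cP1 UP).
Qed.

(** This is the uniqueness of the fundamental operator: [defect P1] is injective on its space, and
    after applying it the two sides agree at x = D_P a by the defining equations, then at limits of
    such x. *)
Lemma unitary_fundamental (S P F : H -> H) (S1 P1 F1 : H1 -> H1) x :
  bdop S -> contraction P -> bdop S1 -> contraction P1 ->
  (forall x, U (S x) = S1 (U x)) -> (forall x, U (P x) = P1 (U x)) ->
  fundamental_operator F S P -> fundamental_operator F1 S1 P1 ->
  defect_space P x -> U (F x) = F1 (U x).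
Proof.
move=> bS cP bS1 cP1 US UP fF fF1 Ex.
have uE := unitary_defect_space cP cP1 UP.
have [[_ Fmem _] FE] := fF; have [[_ F1mem _] F1E] := fF1.
have UE y : defect_space P y -> defect_space P1 (U y).
  by move=> Ey; exact: unitary_on_mem uE Ey.
apply: (defect_inj_on cP1); [exact/UE/Fmem|exact/F1mem/UE|].
have [a ax] := defect_space_tends Ex.
have bU := unitary_bdop; have bD1 := defect_bdop cP1.
have Ea n : defect_space P (defect P (a n)) by exact: defect_spaceP.
have := tends_bdop bD1 (tends_bdop bU (fundamental_tends cP fF Ea Ex ax)).
have := fundamental_tends cP1 fF1 (fun n => UE _ (Ea n)) (UE _ Ex) (tends_bdop bU ax).
move=> /(tends_bdop bD1) h1 h2; apply: tends_unique h2 _; apply: eq_tends h1 => n /=.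
rewrite -(unitary_defect cP cP1 UP) -FE (unitary_defect cP cP1 UP) -F1E.
by rewrite (linB _ _ unitary_lin) US (unitary_adjoint _ bS bS1 US) UP.
Qed.

End UnitaryEquivalence.

(** * Characteristic functions and Gram matrices *)

Section Iterates.
Context {R : realType} {H : hilbertType R}.
Implicit Types (P : H -> H) (x y : H).

Lemma iter_lin P n : lin P -> lin (iter n P).
Proof. by move=> linP; elim: n => [|n IH] a x y //=; rewrite IH linP. Qed.

Lemma nrm_iter P n x : contraction P -> nrm (iter n P x) <= nrm x.
Proof.
by move=> [_ nP]; elim: n => //= n IH; rewrite (le_trans (nP _)).
Qed.

Lemma rin_iter_adjoint P n x y : bdop P ->
  rin (iter n P x) y = rin x (iter n (adjoint P) y).
Proof.
by move=> bP; elim: n x => // n IH x; rewrite iterSr IH rin_adjoint.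
Qed.

Lemma rin_suml (n : nat) (u : nat -> H) y :
  rin (\sum_(i < n) u i) y = \sum_(i < n) rin (u i) y.
Proof.
by elim: n => [|n IH]; rewrite ?big_ord0 ?rin0l// !big_ord_recr/= rinDl IH.
Qed.

Lemma lin_sum (H' : hilbertType R) (T : H -> H') (n : nat) (u : nat -> H) :
  lin T -> T (\sum_(i < n) u i) = \sum_(i < n) T (u i).
Proof.
move=> linT; elim: n => [|n IH]; first by rewrite !big_ord0 lin0.
by rewrite !big_ord_recr/= (linD _ _ linT) IH.
Qed.

End Iterates.

Section Expansion.
Context {R : realType} {H : hilbertType R} (P : H -> H).
Hypothesis cP : contraction P.
Local Notation Q := (adjoint P).
Local Notation Ds := (defect (adjoint P)).

(** For pure P, the maps [cowold n] are the coordinates of an isometric embedding of H into the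
    square-summable sequences of D_{P^*}, on which Q becomes the backward shift; [wold n] is the
    adjoint of the n-th coordinate. *)
Definition wold n e := iter n P (Ds e).
Definition cowold n h := Ds (iter n Q h).

Let cQ : contraction Q := contraction_adjoint cP.
Let P_lin : lin P := bdop_lin cP.1.
Let Q_lin : lin Q := bdop_lin cQ.1.

Lemma cowold_lin n : lin (cowold n).
Proof.
by move=> a x y; rewrite /cowold (iter_lin n Q_lin) (defect_lin cQ).
Qed.

Lemma rin_wold n e h : rin (wold n e) h = rin e (cowold n h).
Proof. by rewrite /wold (rin_iter_adjoint _ _ _ cP.1) (defect_sym cQ). Qed.

Lemma cowold_mem n h : defect_space Q (cowold n h).
Proof. exact: defect_spaceP. Qed.

Lemma sum_wold N h :
  \sum_(n < N) wold n (cowold n h) = h - iter N P (iter N Q h).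
Proof.
elim: N => [|N IH]; first by rewrite big_ord0 subrr.
rewrite big_ord_recr/= IH /wold /cowold (defect_adjoint_sqr cP).
by rewrite (linB _ _ (iter_lin N P_lin)) addrA subrK -iterSr.
Qed.

Lemma sum_wold_tends h : pure P ->
  tends (fun N => \sum_(n < N) wold n (cowold n h)) h.
Proof.
move=> /(_ h)/cvg_tends Qh e /Qh[N QN]; exists N => n /QN; apply: le_lt_trans.
by rewrite sum_wold addrAC subrr sub0r nrmN subr0 nrm_iter.
Qed.

Lemma cowold_inj h g : pure P -> (forall n, cowold n h = cowold n g) -> h = g.
Proof.
move=> pP hg; apply: tends_unique (sum_wold_tends h pP) _.
by apply: eq_tends (sum_wold_tends g pP) => N; apply: eq_bigr => n _; rewrite hg.
Qed.

Lemma contraction_defect_space x : defect_space P x -> defect_space Q (P x).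
Proof.
move=> /defect_space_tends[a ax].
apply: closure_idem_tends (tends_bdop cP.1 ax) => n /=.
by rewrite contraction_defect//; exact: defect_spaceP.
Qed.

Lemma adjoint_defect_space x : defect_space Q x -> defect_space P (Q x).
Proof.
move=> /defect_space_tends[a ax].
apply: closure_idem_tends (tends_bdop cQ.1 ax) => n /=.
by rewrite adjoint_defect//; exact: defect_spaceP.
Qed.

(** With the next two lemmas, this is a recursion for the Gram matrix whose inputs are inner
    products among e, Q e and D_P P^n D_{P^*} e, vectors of the defect spaces which a coincidence
    transports. *)
Lemma wold_rin0 e f : rin (wold 0 e) (wold 0 f) = rin e f - rin (Q e) (Q f).
Proof.
rewrite (sqr_nrm_defect cQ) /wold /=; ring.
Qed.

Lemma wold_rinS0 n e f :
  rin (wold n.+1 e) (wold 0 f) = rin (defect P (wold n e)) (Q f).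
Proof.
rewrite rinC rin_wold -[cowold 0 _]/(Ds (P (wold n e))) -(contraction_defect cP).
by rewrite rinC (rin_adjoint _ _ cP.1).
Qed.

Lemma wold_rinSS n m e f :
  rin (wold n.+1 e) (wold m.+1 f) = rin (wold n e) (wold m f)
    - rin (defect P (wold n e)) (defect P (wold m f)).
Proof. exact: (sqr_nrm_defect cP). Qed.

End Expansion.

Section Coincidence.
Context {R : realType} {H H1 : hilbertType R}.
Variables (P : H -> H) (P1 : H1 -> H1) (s t : H -> H1).
Hypotheses (cP : contraction P) (cP1 : contraction P1).
Local Notation Q := (adjoint P).
Local Notation Q1 := (adjoint P1).
Local Notation D := (defect P).
Local Notation D1 := (defect P1).
Local Notation Ds := (defect (adjoint P)).
Local Notation Ds1 := (defect (adjoint P1)).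
Local Notation E := (defect_space P).
Local Notation E1 := (defect_space P1).
Local Notation Es := (defect_space (adjoint P)).
Local Notation Es1 := (defect_space (adjoint P1)).
Hypotheses (us : unitary_on E E1 s) (ut : unitary_on Es Es1 t).
Hypothesis coincide : forall z : R[i], `|z| < 1 -> forall x, E x ->
  t (char_fun P z x) = char_fun P1 z (s x).

Let cQ : contraction Q := contraction_adjoint cP.
Let cQ1 : contraction Q1 := contraction_adjoint cP1.
Let t_lin : linear_on Es t. Proof. by case: ut. Qed.
Let sEs : subspace Es := defect_space_subspace cQ.

Lemma coincide_contraction x : E x -> t (P x) = P1 (s x).
Proof.
move=> Ex; have := @coincide 0; rewrite normr0 => /(_ ltr01 _ Ex).
rewrite /char_fun !scale0r !addr0 -[- P x]scaleN1r (linear_onZ sEs t_lin).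
  by rewrite scaleN1r => /oppr_inj.
exact: contraction_defect_space.
Qed.

Let res z x := pinv setT (fun y => y - z *: Q y) (D x).
Let res1 z x := pinv setT (fun y => y - z *: Q1 y) (D1 (s x)).

(* Dividing by z and letting z go to 0 reads off the Taylor coefficients of the
   characteristic functions one after the other. *)
Lemma coincide_cowold n x : E x -> t (cowold P n (D x)) = cowold P1 n (D1 (s x)).
Proof.
move=> Ex.
have resE z : `|z| < 1 -> res z x = D x + z *: Q (res z x).
  by move=> z1; rewrite -(pinv_resolvent cQ z1 (D x)) subrK.
have res1E z : `|z| < 1 -> res1 z x = D1 (s x) + z *: Q1 (res1 z x).
  by move=> z1; rewrite -(pinv_resolvent cQ1 z1 (D1 (s x))) subrK.
(* [cowold P m (res z x)] is the sum over k of z^k D_{P^*} Q^(m+k) D_P x, a tail of the power series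
   with its power of z divided out; expanding [res] once splits off the first coefficient. *)
pose same m := forall z, z != 0 -> `|z| < 1 ->
  t (cowold P m (res z x)) = cowold P1 m (res1 z x).
have step m : same m -> t (cowold P m (D x)) = cowold P1 m (D1 (s x)) /\ same m.+1.
  move=> same_m; set a := t _; set b := cowold _ _ _.
  have key z : z != 0 -> `|z| < 1 ->
      a - b = z *: (cowold P1 m.+1 (res1 z x) - t (cowold P m.+1 (res z x))).
    move=> z0 z1; have := same_m z z0 z1.
    rewrite {1}(resE _ z1) {1}(res1E _ z1) [_ + z *: _]addrC [D1 _ + _]addrC.
    rewrite (cowold_lin cP) (cowold_lin cP1) t_lin; try exact: cowold_mem.
    rewrite /cowold -!iterSr -!/(cowold _ m.+1 _) -/a -/b scalerBr => ab.
    by apply/eqP; rewrite subr_eq addrAC -ab addrAC subrr add0r.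
  have ab : a = b.
    apply/eqP; rewrite -subr_eq0; apply/eqP/nrm_eq0/eqP; rewrite eq_le nrm_ge0 andbT.
    set M := nrm (D1 (s x)) + nrm (D x).
    (* At z = e at most 1/2, the equation of the resolvent gives |res| <= 2 |D x|, and likewise for
       [res1]; this is the factor 2 M. *)
    have bnd (e : R) : 0 < e -> e <= 2^-1 -> nrm (a - b) <= e * (2 * M).
      move=> e0 e2.
      have z0 : e%:C%C != 0 by rewrite gt_eqF// ltr0c.
      have z1 : `|e%:C%C| < 1.
        by rewrite ger0_norm ?ler0c ?ltW// ltcR (le_lt_trans e2)// invf_lt1// ltr1n.
      rewrite (key _ z0 z1) nrmZr (ger0_norm (ltW e0)) ler_pM2l//.
      apply: (le_trans (nrmB _ _)).
      have h1 : nrm (cowold P1 m.+1 (res1 e%:C%C x)) <= nrm (res1 e%:C%C x).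
        by rewrite (le_trans (nrm_defect cQ1 _))// nrm_iter.
      have h2 : nrm (t (cowold P m.+1 (res e%:C%C x))) <= nrm (res e%:C%C x).
        have -> : nrm (t (cowold P m.+1 (res e%:C%C x))) =
            nrm (cowold P m.+1 (res e%:C%C x)).
          apply/eqP; rewrite -(@eqrXn2 _ 2) ?nrm_ge0// -!rinxx.
          by rewrite (unitary_on_rin ut)//; exact: cowold_mem.
        by rewrite (le_trans (nrm_defect cQ _))// nrm_iter.
      have h3 : nrm (res1 e%:C%C x) <= nrm (D1 (s x)) + e * nrm (res1 e%:C%C x).
        rewrite {1}(res1E _ z1) (le_trans (nrmD _ _))// lerD2l nrmZr (ger0_norm (ltW e0)).
        by rewrite ler_pM2l// cQ1.2.
      have h4 : nrm (res e%:C%C x) <= nrm (D x) + e * nrm (res e%:C%C x).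
        rewrite {1}(resE _ z1) (le_trans (nrmD _ _))// lerD2l nrmZr (ger0_norm (ltW e0)).
        by rewrite ler_pM2l// cQ.2.
      have h5 := ler_wpM2r (nrm_ge0 (res e%:C%C x)) e2.
      have h6 := ler_wpM2r (nrm_ge0 (res1 e%:C%C x)) e2.
      rewrite /M; lra.
    have M0 : 0 <= M by rewrite addr_ge0// nrm_ge0.
    apply/ler_addgt0Pr => e e0; rewrite add0r.
    have d0 : 0 < 2 * M + 2 * e by rewrite ltr_wpDl ?mulr_ge0// mulr_gt0.
    (* This value is at most 1/2, as [bnd] requires, and its product with 2 M is at most e. *)
    have := bnd (e / (2 * M + 2 * e)); rewrite divr_gt0// => /(_ isT).
    rewrite ler_pdivrMr// => h; apply: le_trans (h _) _; first lra.
    by rewrite -mulrA ler_piMr ?(ltW e0)// ler_pdivrMl//; lra.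
  split=> // z z0 z1; have := key z z0 z1; rewrite ab subrr => /esym/eqP.
  by rewrite scaler_eq0 (negbTE z0)/= subr_eq0 => /eqP.
suff same_n : same n by case: (step n same_n).
(* For m = 0, the constant terms - P x and - P1 (s x) are matched and removed, and the remaining
   factor z is cancelled; hence the condition z != 0 in [same]. *)
elim: n => [z z0 z1|n /step[]//].
have := coincide z1 Ex; rewrite /char_fun -/(res z x) -/(res1 z x).
rewrite [- P x + _]addrC [- P1 _ + _]addrC.
rewrite t_lin; last 2 first.
- exact: defect_spaceP.
- rewrite -[- P x]scaleN1r -[_ *: _]addr0; apply: sEs.2 sEs.1.
  exact: contraction_defect_space.
rewrite -[- P x]scaleN1r (linear_onZ sEs t_lin); last exact: contraction_defect_space.
rewrite coincide_contraction// scaleN1r => /addIr/(scalerI z0).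
by [].
Qed.

(** The adjoint of [coincide_contraction], obtained by testing against the vectors s x, which fill
    [E1]. *)
Lemma coincide_adjoint e : Es e -> s (Q e) = Q1 (t e).
Proof.
move=> Ee; have EQ := adjoint_defect_space cP Ee.
apply: (unitary_on_ext us); first exact: unitary_on_mem us EQ.
  exact/(adjoint_defect_space cP1)/(unitary_on_mem ut).
move=> x Ex; rewrite (unitary_on_rin us)// rinC -(rin_adjoint _ _ cP.1).
rewrite -(unitary_on_rin ut)//; last exact: contraction_defect_space.
by rewrite coincide_contraction// (rin_adjoint _ _ cP1.1) rinC.
Qed.

(** Dual to [coincide_cowold] by the same test, D_P [wold n] being the adjoint of [cowold n] D_P. *)
Lemma coincide_wold n e : Es e -> s (D (wold P n e)) = D1 (wold P1 n (t e)).
Proof.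
move=> Ee; have EQ := @defect_spaceP _ _ P (wold P n e).
apply: (unitary_on_ext us); first exact: unitary_on_mem us EQ.
  exact: defect_spaceP.
move=> x Ex; rewrite (unitary_on_rin us)// (defect_sym cP) (rin_wold cP).
rewrite -(unitary_on_rin ut)//; last exact: cowold_mem.
by rewrite coincide_cowold// -(rin_wold cP1) (defect_sym cP1).
Qed.

Lemma coincide_gram n m e f : Es e -> Es f ->
  rin (wold P n e) (wold P m f) = rin (wold P1 n (t e)) (wold P1 m (t f)).
Proof.
have S0 k e' f' : Es e' -> Es f' -> rin (wold P k.+1 e') (wold P 0 f') =
    rin (wold P1 k.+1 (t e')) (wold P1 0 (t f')).
  move=> Ee Ef; rewrite (wold_rinS0 cP) (wold_rinS0 cP1).
  rewrite -coincide_wold// -coincide_adjoint// (unitary_on_rin us)//.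
    exact: defect_spaceP.
  exact: adjoint_defect_space.
move=> Ee Ef; elim: n m => [|n IH] [|m].
- rewrite (wold_rin0 cP) (wold_rin0 cP1) -!coincide_adjoint//.
  by rewrite (unitary_on_rin us) ?(unitary_on_rin ut)//; exact: adjoint_defect_space.
- by rewrite rinC S0// rinC.
- exact: S0.
- rewrite (wold_rinSS cP) (wold_rinSS cP1) IH -!coincide_wold//.
  by rewrite (unitary_on_rin us)//; exact: defect_spaceP.
Qed.

End Coincidence.

(** * Reconstruction of the unitary *)

Section WoldUnitary.
Context {R : realType} {H H1 : hilbertType R}.
Variables (P : H -> H) (P1 : H1 -> H1) (t : H -> H1).
Hypotheses (cP : contraction P) (cP1 : contraction P1).
Hypotheses (pP : pure P) (pP1 : pure P1).
Local Notation Q := (adjoint P).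
Local Notation Q1 := (adjoint P1).
Local Notation Es := (defect_space (adjoint P)).
Local Notation Es1 := (defect_space (adjoint P1)).
Hypothesis ut : unitary_on Es Es1 t.
Hypothesis gram : forall n m e f, Es e -> Es f ->
  rin (wold P n e) (wold P m f) = rin (wold P1 n (t e)) (wold P1 m (t f)).

(** [part1 h] is what the partial sums of the expansion of h become after transport by t. Equal Gram
    matrices give both families the same inner products, so the Cauchy property carries over and U h
    can be defined as the limit. *)
Let part h N := \sum_(n < N) wold P n (cowold P n h).
Let part1 h N := \sum_(n < N) wold P1 n (t (cowold P n h)).

Let part1_wold h N k f : Es f ->
  rin (part1 h N) (wold P1 k (t f)) = rin (part h N) (wold P k f).
Proof.
move=> Ef; rewrite (rin_suml N (fun n => wold P1 n (t (cowold P n h)))).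
rewrite (rin_suml N (fun n => wold P n (cowold P n h))); apply: eq_bigr => n _.
by rewrite gram//; exact: cowold_mem.
Qed.

Let part1_rin h g N M : rin (part1 h N) (part1 g M) = rin (part h N) (part g M).
Proof.
rewrite rinC [RHS]rinC (rin_suml M (fun n => wold P1 n (t (cowold P n g)))).
rewrite (rin_suml M (fun n => wold P n (cowold P n g))); apply: eq_bigr => n _.
by rewrite rinC [RHS]rinC part1_wold//; exact: cowold_mem.
Qed.

Let part1_cvg h : exists h1, tends (part1 h) h1.
Proof.
apply: hilbert_complete => e e0.
have [N PN] := tends_cauchy (sum_wold_tends cP h pP) e0.
exists N => m n Nm Nn; have := PN _ _ Nm Nn; rewrite -/(part h m) -/(part h n).
congr (_ < _); apply/eqP; rewrite -(@eqrXn2 _ 2) ?nrm_ge0//.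
by rewrite !sqr_nrmB -!rinxx !part1_rin.
Qed.

Lemma exists_wold_unitary : exists U : H -> H1, unitary_on setT setT U /\
  forall n h, cowold P1 n (U h) = t (cowold P n h).
Proof.
have [U UP] : exists U : H -> H1, forall h, tends (part1 h) (U h).
  by have /choice[U UP] := part1_cvg; exists U.
have partP h := sum_wold_tends cP h pP.
have U_rin h g : rin (U h) (U g) = rin h g.
  rewrite rinC [RHS]rinC; apply: rin_lim2 (UP g) (partP g) _ => M.
  by rewrite rinC [RHS]rinC; apply: rin_lim2 (UP h) (partP h) _ => N; exact: part1_rin.
have cowoldU n h : cowold P1 n (U h) = t (cowold P n h).
  apply: (unitary_on_ext ut); first exact: cowold_mem.
    exact/(unitary_on_mem ut)/cowold_mem.
  move=> f Ef; rewrite (unitary_on_rin ut)//; last exact: cowold_mem.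
  rewrite rinC -(rin_wold cP1) rinC [RHS]rinC -(rin_wold cP) [RHS]rinC.
  by apply: rin_lim2 (UP h) (partP h) _ => N; exact: part1_wold.
(* As [P1] is pure, the coordinates [cowold P1 n] determine a vector; linearity of U and its action
   on [wold] are then checked coordinate by coordinate. *)
have charU : forall h h1,
    (forall n, cowold P1 n h1 = t (cowold P n h)) -> U h = h1.
  by move=> h h1 hh1; apply: (cowold_inj cP1 pP1) => n; rewrite cowoldU hh1.
have U_lin : lin U.
  move=> a x y; apply: charU => n; rewrite (cowold_lin cP1) (cowold_lin cP) !cowoldU.
  by have [t_lin _ _] := ut; rewrite t_lin//; exact: cowold_mem.
have U_nrm h : nrm (U h) = nrm h.
  by apply/eqP; rewrite -(@eqrXn2 _ 2) ?nrm_ge0// -!rinxx U_rin.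
have U_bdop : bdop U by split=> //; exists 1 => // x; rewrite mul1r U_nrm.
have U_wold n e : Es e -> U (wold P n e) = wold P1 n (t e).
  move=> Ee; apply: charU => m; apply: (unitary_on_ext ut).
  - exact: cowold_mem.
  - exact/(unitary_on_mem ut)/cowold_mem.
  move=> f Ef; rewrite (unitary_on_rin ut)//; last exact: cowold_mem.
  by rewrite rinC -(rin_wold cP1) [RHS]rinC -(rin_wold cP) gram.
exists U; split=> //; split.
- by move=> a x y _ _; exact: U_lin.
(* Surjectivity: the coordinates of h1 are lifted through t and reassembled in H. The sums are
   Cauchy because the isometry U sends them to the partial sums of h1. *)
- apply/seteqP; split=> // h1 _.
  have /choice[e eP] : forall n, exists e, Es e /\ t e = cowold P1 n h1.
    move=> n; have [e Ee te] := unitary_on_surj ut (@cowold_mem _ _ P1 n h1).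
    by exists e.
  pose g N := \sum_(n < N) wold P n (e n).
  have Ug N : U (g N) = \sum_(n < N) wold P1 n (cowold P1 n h1).
    rewrite /g (lin_sum N (fun n => wold P n (e n)) U_lin); apply: eq_bigr => n _.
    by have [Ee te] := eP n; rewrite U_wold// te.
  have h1P := sum_wold_tends cP1 h1 pP1.
  have [x gx] : exists x, tends g x.
    apply: hilbert_complete => d d0; have [N NP] := tends_cauchy h1P d0.
    exists N => m n Nm Nn; rewrite -U_nrm (linB _ _ U_lin) !Ug.
    exact: NP.
  exists x => //; apply: tends_unique (tends_bdop U_bdop gx) _.
  by apply: eq_tends h1P => N; rewrite -Ug.
- move=> x y _ _.
  exact: (inner_ext U_lin (_ : lin id) (fun x => U_rin x y)).
Qed.

End WoldUnitary.

(** * The constructed unitary intertwines the adjoints of P and S with those of P1 and S1 *)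

Section Converse.
Context {R : realType} {H H1 : hilbertType R}.
Variables (S P F : H -> H) (S1 P1 F1 : H1 -> H1) (t : H -> H1).
Hypotheses (bS : bdop S) (bS1 : bdop S1).
Hypotheses (cP : contraction P) (cP1 : contraction P1).
Hypotheses (SP : forall x, S (P x) = P (S x)) (SP1 : forall x, S1 (P1 x) = P1 (S1 x)).
Hypotheses (pP1 : pure P1).
Local Notation Es := (defect_space (adjoint P)).
Local Notation Es1 := (defect_space (adjoint P1)).
Hypothesis ut : unitary_on Es Es1 t.
Hypothesis fF : fundamental_operator F (adjoint S) (adjoint P).
Hypothesis fF1 : fundamental_operator F1 (adjoint S1) (adjoint P1).
Hypothesis tF : forall x, Es x -> t (F x) = F1 (t x).
Variable U : H -> H1.
Hypothesis uU : unitary_on setT setT U.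
Hypothesis cowoldU : forall n h, cowold P1 n (U h) = t (cowold P n h).

Lemma adjoint_comm (K : hilbertType R) (T V : K -> K) : bdop T -> bdop V ->
  (forall x, T (V x) = V (T x)) ->
  forall x, adjoint T (adjoint V x) = adjoint V (adjoint T x).
Proof.
move=> bT bV TV x; apply: rin_ext => y.
by rewrite -!rin_adjoint// TV.
Qed.

Lemma iter_comm (T : Type) (f g : T -> T) n x :
  (forall x, f (g x) = g (f x)) -> iter n f (g x) = g (iter n f x).
Proof. by move=> fg; elim: n => //= n ->. Qed.

(** Applying Q raises the index of every coordinate by one, on both sides. *)
Lemma wold_unitary_adjoint x : U (adjoint P x) = adjoint P1 (U x).
Proof.
apply: (cowold_inj cP1 pP1) => n; rewrite cowoldU /cowold -!iterSr.
exact/esym/(cowoldU n.+1).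
Qed.

Lemma wold_unitary_adjoint_comm x : U (adjoint S x) = adjoint S1 (U x).
Proof.
have cQ := contraction_adjoint cP; have cQ1 := contraction_adjoint cP1.
have SQ := adjoint_comm bS cP.1 SP; have SQ1 := adjoint_comm bS1 cP1.1 SP1.
have UQ n y : iter n (adjoint P1) (U y) = U (iter n (adjoint P) y).
  by elim: n => //= n ->; rewrite wold_unitary_adjoint.
have key y : defect (adjoint P1) (adjoint S1 (U y)) =
    t (defect (adjoint P) (adjoint S y)).
  have Emem z : Es (defect (adjoint P) z) by exact: defect_spaceP.
  apply: (unitary_on_ext ut); first exact: defect_spaceP.
    exact: (unitary_on_mem ut (Emem _)).
  move=> f Ef; have Fmem z : Es z -> Es (F z) by case: fF => -[_ + _] _; apply.
  rewrite (unitary_on_rin ut)//.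
  have Etf := unitary_on_mem ut Ef.
  rewrite (fundamental_adjoint_rin cQ1 (U y) (adjoint_bdop bS1) SQ1 fF1 Etf).
  rewrite (fundamental_adjoint_rin cQ y (adjoint_bdop bS) SQ fF Ef).
  rewrite -wold_unitary_adjoint (cowoldU 0 y : defect _ (U y) = _).
  rewrite (cowoldU 0 (adjoint P y) : defect _ (U _) = _).
  rewrite -(tF Ef) -(tF (Emem y)).
  by rewrite !(unitary_on_rin ut)//; by [exact: Emem|exact: Fmem|exact/Fmem/Emem].
(* S^* commutes with Q^n, so the n-th coordinate of S^* x is D_{P^*} S^* at Q^n x, and [key] at that
   vector concludes. *)
apply: (cowold_inj cP1 pP1) => n; rewrite cowoldU /cowold.
rewrite (iter_comm n x) => [|y]; last by rewrite SQ.
rewrite (iter_comm n (U x)) => [|y]; last by rewrite SQ1.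
by rewrite UQ key.
Qed.

End Converse.

Unset Implicit Arguments.

Theorem theorem4p4 (R : realType) (H H1 : hilbertType R)
    (S P Fs : H -> H) (S1 P1 Fs1 : H1 -> H1) :
  Gamma_contraction S P -> pure P ->
  Gamma_contraction S1 P1 -> pure P1 ->
  fundamental_operator Fs (adjoint S) (adjoint P) ->
  fundamental_operator Fs1 (adjoint S1) (adjoint P1) ->
  (exists U : H -> H1,
     [/\ unitary_on setT setT U, U \o S = S1 \o U & U \o P = P1 \o U ])
  <->
  (exists sigma sigmas : H -> H1,
     [/\ unitary_on (defect_space P) (defect_space P1) sigma,
         unitary_on (defect_space (adjoint P)) (defect_space (adjoint P1)) sigmas,
         forall z : R[i], `|z| < 1 -> forall x, defect_space P x ->
           sigmas (char_fun P z x) = char_fun P1 z (sigma x)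
       & forall x, defect_space (adjoint P) x -> sigmas (Fs x) = Fs1 (sigmas x) ]).
Proof.
move=> gSP pP gSP1 pP1 fF fF1.
have cP := Gamma_contraction_contraction gSP.
have cP1 := Gamma_contraction_contraction gSP1.
have [/bounded_operatorE bS _ SP _] := gSP.
have [/bounded_operatorE bS1 _ SP1 _] := gSP1.
split=> [[U [uU /funeqP US /funeqP UP]]|[s [t [us ut st tF]]]].
  have cQ := contraction_adjoint cP; have cQ1 := contraction_adjoint cP1.
  have UQ x := unitary_adjoint uU x cP.1 cP1.1 UP.
  have UA x := unitary_adjoint uU x bS bS1 US.
  (* U serves as both unitaries, since only its values on each defect space matter. *)
  exists U, U; split; first exact: (unitary_defect_space uU cP cP1 UP).
  - exact: (unitary_defect_space uU cQ cQ1 UQ).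
  - by move=> z z1 x _; exact: unitary_char_fun.
  - move=> x; have bA := adjoint_bdop bS; have bA1 := adjoint_bdop bS1.
    exact: (unitary_fundamental uU bA cQ bA1 cQ1 UA UQ fF fF1).
have [U [uU UK]] := exists_wold_unitary cP cP1 pP pP1 ut
  (coincide_gram cP cP1 us ut st).
have UQ := wold_unitary_adjoint cP1 pP1 UK.
have /funeqP SPx := SP; have /funeqP SP1x := SP1.
have UA := wold_unitary_adjoint_comm bS bS1 cP cP1 SPx SP1x pP1 ut
  fF fF1 tF UK.
(* U intertwines P^* and S^* with their counterparts; a second passage to adjoints returns to S and
   P. *)
exists U; split=> //; apply/funext => x /=.
  have := unitary_adjoint uU x (adjoint_bdop bS) (adjoint_bdop bS1) UA.
  by rewrite !adjointK.
have := unitary_adjoint uU x (adjoint_bdop cP.1) (adjoint_bdop cP1.1) UQ.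
by rewrite !adjointK//; [case: cP1|case: cP].
Qed.
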